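(* The intrinsic valuation entropy $$\widetilde{\mathrm{ent}}_v\colon \mathrm{Mod}(R[X])\to \mathbb R_{\geq 0}\cup\{\infty\}$$ is a length function on the category $\mathrm{Mod}(R[X])$ of $R[X]$-modules.
   Context: $R$ is a non-discrete archimedean valuation domain: a valuation domain with field of fractions $Q$ and valuation $v\colon Q\to\Gamma(R)\cup\{\infty\}$ whose value group $\Gamma(R)$ is a dense subgroup of the ordered additive group $\mathbb R$. Put $\mathbb R^*=\mathbb R_{\ge 0}\cup\{\infty\}$. For a ring $S$, a function $L\colon \mathrm{Mod}(S)\to\mathbb R^*$ is an invariant if $L(0)=0$ and $L(M)=L(M')$ whenever $M\cong M'$; it is additive if $L(M)=L(M')+L(M'')$ for every short exact sequence $0\to M'\to M\to M''\to 0$; it is upper continuous if $L(M)=\sup\{L(F): F\le M \text{ finitely generated}\}$. A length function is an additive and upper continuous invariant. $L_v\colon\mathrm{Mod}(R)\to\mathbb R^*$ denotes the (unique) length function with $L_v(R/I)=\inf_{r\in I}v(r)$ for every ideal $I$ of $R$ (Northcott–Reufel). For an $R$-module $M$ and $\phi\in\mathrm{End}_R(M)$, $M_\phi$ denotes the $R[X]$-module $M$ on which $X$ acts as $\phi$; every $R[X]$-module is of this form. For an $R$-submodule $K\le M$ and $n\ge1$, $T_n(\phi,K)=K+\phi K+\dots+\phi^{n-1}K$. An $R$-submodule $H\le M$ is $\phi$-inert if $L_v((H+\phi H)/H)<\infty$; $\mathcal I_\phi(M)$ is the set of $\phi$-inert submodules of $M$. For $H\in\mathcal I_\phi(M)$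 one has $L_v(T_n(\phi,H)/H)<\infty$ for all $n\ge 1$, and one sets $\widetilde{\mathrm{ent}}_v(\phi,H)=\lim_{n\to\infty}\frac{L_v(T_n(\phi,H)/H)}{n}$ (the limit exists). The intrinsic valuation entropy is $\widetilde{\mathrm{ent}}_v(M_\phi)=\widetilde{\mathrm{ent}}_v(\phi)=\sup_{H\in\mathcal I_\phi(M)}\widetilde{\mathrm{ent}}_v(\phi,H)$. *)

(* Defs.v *)
From HB Require Import structures.
From mathcomp Require Import all_boot all_order all_algebra.
From mathcomp Require Import generic_quotient ring_quotient fraction.
From mathcomp Require Import all_classical all_reals all_analysis.
Import numFieldNormedType.Exports.
Import Order.TTheory GRing.Theory Num.Theory.

Set Implicit Arguments.
Unset Strict Implicit.
Unset Printing Implicit Defensive.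

Local Open Scope classical_set_scope.
Local Open Scope ring_scope.
Local Open Scope quotient_scope.

(* Submodules of V are the boolean predicates [submodClosed V]; by classical
   logic every subset closed under the operations is of this form. *)
Section Submodules.
Variables (S : pzRingType) (V : lmodType S).
Implicit Types (A B : submodClosed V).

Definition mk_submod (P : set V)
    (hP : subsemimod_closed (fun x => `[< P x >])) : submodClosed V :=
  HB.pack (fun x => `[< P x >] : bool)
    (@GRing.isSubmodClosed.Build S V (fun x => `[< P x >]) hP).

Lemma submod_zero_subproof : subsemimod_closed (fun x : V => `[< x = 0 >]).
Proof.
split; first split.
- by apply/asboolP.
- by move=> x y /asboolP -> /asboolP ->; apply/asboolP; rewrite addr0.
- by move=> a x /asboolP ->; apply/asboolP; rewrite scaler0.
Qed.

Definition submod_zero : submodClosed V := mk_submod submod_zero_subproof.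

Lemma submod_add_subproof A B : subsemimod_closed
  (fun x : V => `[< exists a b, [/\ a \in A, b \in B & x = a + b] >]).
Proof.
split; first split.
- by apply/asboolP; exists 0, 0; rewrite !rpred0 addr0.
- move=> x y /asboolP[a [b [aA bB ->]]] /asboolP[a' [b' [aA' bB' ->]]].
  by apply/asboolP; exists (a + a'), (b + b'); rewrite !rpredD // addrACA.
- move=> c x /asboolP[a [b [aA bB ->]]].
  by apply/asboolP; exists (c *: a), (c *: b); rewrite !rpredZ // scalerDr.
Qed.

Definition submod_add A B : submodClosed V :=
  mk_submod (submod_add_subproof A B).

Definition finitely_generated A : Prop :=
  exists s : seq V, forall x, x \in A <->
    exists c : 'I_(size s) -> S, x = \sum_(i < size s) c i *: s`_i.

Record submod_type A := SubmodElt { submod_val : V; _ : submod_val \in A }.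
HB.instance Definition _ A := [isSub for @submod_val A].
HB.instance Definition _ A := [Choice of submod_type A by <:].
HB.instance Definition _ A :=
  [SubChoice_isSubLmodule of submod_type A by <:].

Definition submod_zmodClosed A : zmodClosed V :=
  HB.pack (A : {pred V})
    (@GRing.isZmodClosed.Build V (A : {pred V})
      (GRing.submod_closedB (submodClosedP A))).

Definition quot_module A : Type := {ideal_quot (submod_zmodClosed A)}.
HB.instance Definition _ A := GRing.Zmodule.on (quot_module A).

Definition quot_proj A (x : V) : quot_module A :=
  \pi_({ideal_quot (submod_zmodClosed A)}) x.

Lemma quot_projP A (q : quot_module A) : exists x, q = quot_proj A x.
Proof. by exists (repr q); rewrite /quot_proj reprK. Qed.

Lemma quot_proj_eq A x y : (quot_proj A x == quot_proj A y) = (x - y \in A).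
Proof. exact: esym (Quotient.idealrBE (submod_zmodClosed A) x y). Qed.

Lemma quot_projD A : {morph quot_proj A : x y / x + y}.
Proof. exact: (Quotient.pi_add (submod_zmodClosed A)). Qed.

Definition quot_scale A (a : S) (q : quot_module A) : quot_module A :=
  quot_proj A (a *: repr q).

Lemma quot_scaleE A a x : quot_scale a (quot_proj A x) = quot_proj A (a *: x).
Proof.
apply/eqP; rewrite quot_proj_eq -scalerBr rpredZ // -quot_proj_eq.
by rewrite /quot_proj reprK eqxx.
Qed.

Lemma quot_scalerA A a b (q : quot_module A) :
  quot_scale a (quot_scale b q) = quot_scale (a * b) q.
Proof. by have [x ->] := quot_projP q; rewrite !quot_scaleE scalerA. Qed.

Lemma quot_scale1r A : left_id 1 (@quot_scale A).
Proof. by move=> q; have [x ->] := quot_projP q; rewrite quot_scaleE scale1r. Qed.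

Lemma quot_scalerDr A : right_distributive (@quot_scale A) +%R.
Proof.
move=> a p q; have [x ->] := quot_projP p; have [y ->] := quot_projP q.
by rewrite -quot_projD !quot_scaleE scalerDr quot_projD.
Qed.

Lemma quot_scalerDl A (q : quot_module A) :
  {morph (@quot_scale A)^~ q : a b / a + b}.
Proof.
by move=> a b; have [x ->] := quot_projP q; rewrite !quot_scaleE scalerDl quot_projD.
Qed.

HB.instance Definition _ A := GRing.Zmodule_isLmodule.Build S (quot_module A)
  (@quot_scalerA A) (@quot_scale1r A) (@quot_scalerDr A) (@quot_scalerDl A).

End Submodules.

Section Images.
Variables (S : pzRingType) (V W : lmodType S) (f : {linear V -> W}).

Lemma submod_image_subproof (A : submodClosed V) :
  subsemimod_closed (fun y : W => `[< exists2 x, x \in A & y = f x >]).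
Proof.
split; first split.
- by apply/asboolP; exists 0; rewrite ?rpred0 ?linear0.
- move=> _ _ /asboolP[x xA ->] /asboolP[y yA ->].
  by apply/asboolP; exists (x + y); rewrite ?rpredD ?linearD.
- move=> a _ /asboolP[x xA ->].
  by apply/asboolP; exists (a *: x); rewrite ?rpredZ ?linearZ.
Qed.

Definition submod_image (A : submodClosed V) : submodClosed W :=
  mk_submod (submod_image_subproof A).

Lemma submod_preimage_subproof (B : submodClosed W) :
  subsemimod_closed (fun x : V => `[< f x \in B >]).
Proof.
split; first split.
- by apply/asboolP; rewrite linear0 rpred0.
- by move=> x y /asboolP xB /asboolP yB; apply/asboolP; rewrite linearD rpredD.
- by move=> a x /asboolP xB; apply/asboolP; rewrite linearZ rpredZ.
Qed.

Definition submod_preimage (B : submodClosed W) : submodClosed V :=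
  mk_submod (submod_preimage_subproof B).

End Images.

(* A / (A `&` B), where A `&` B is seen inside A; it is only used when B is
   contained in A, where it is A / B. *)
Definition subquotient (S : pzRingType) (V : lmodType S)
    (A B : submodClosed V) : lmodType S :=
  quot_module (submod_preimage (\val : {linear submod_type A -> V}) B).

Section LengthFunctions.
Variables (K : realType) (S : pzRingType) (L : lmodType S -> \bar K).

Definition isomorphic (M N : lmodType S) : Prop :=
  exists f : {linear M -> N}, bijective f.

Definition short_exact (M' M M'' : lmodType S)
    (f : {linear M' -> M}) (g : {linear M -> M''}) : Prop :=
  [/\ injective f, (forall y, g y = 0 <-> exists x, f x = y) &
      (forall z, exists y, g y = z)].

Definition module_invariant : Prop :=
  (forall M : lmodType S, (forall x : M, x = 0) -> L M = 0%E) /\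
  (forall M N : lmodType S, isomorphic M N -> L M = L N).

Definition additive_invariant : Prop :=
  forall (M' M M'' : lmodType S) (f : {linear M' -> M}) (g : {linear M -> M''}),
    short_exact f g -> L M = (L M' + L M'')%E.

Definition upper_continuous : Prop :=
  forall M : lmodType S,
    L M = ereal_sup [set L (submod_type A) | A in @finitely_generated S M].

Record length_function : Prop := LengthFunction {
  length_ge0 : forall M, (0 <= L M)%E ;
  length_invariant : module_invariant ;
  length_additive : additive_invariant ;
  length_upper_continuous : upper_continuous }.

End LengthFunctions.

Section Valuation.
Variables (K : realType) (R : idomainType) (v : {fraction R} -> \bar K).

(* v is a valuation of the field of fractions of R whose valuation ring is R
   (so that R is a valuation domain); its value group, the set of the finite
   values of v, is a subgroup of K. *)
Record nondiscrete_archimedean_valuation : Prop := NonDiscreteArchimedean {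
  val_neq_ninfty : forall x, v x != -oo%E ;
  val_infty : forall x, v x = +oo%E <-> x = 0 ;
  val_mul : forall x y, v (x * y) = (v x + v y)%E ;
  val_add : forall x y, (Order.min (v x) (v y) <= v (x + y)%R)%E ;
  val_ring : forall x, (0 <= v x)%E <-> exists r : R, x = tofrac r ;
  val_dense : dense [set g : K | exists x, v x = g%:E] }.

Definition valuation_length (L : lmodType R -> \bar K) : Prop :=
  length_function L /\
  forall I : submodClosed R^o,
    L (quot_module I) = ereal_inf [set v (tofrac r) | r in [set r : R | (r : R^o) \in I]].

End Valuation.

Section Entropy.
Variables (K : realType) (R : pzRingType) (L : lmodType R -> \bar K).
Variables (M : lmodType R) (phi : {linear M -> M}).

Definition inert (H : submodClosed M) : Prop :=
  (L (subquotient (submod_add H (submod_image phi H)) H) < +oo)%E.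

Definition trajectory (n : nat) (H : submodClosed M) : submodClosed M :=
  \big[@submod_add R M/submod_zero M]_(i < n) iter i (submod_image phi) H.

Definition intrinsic_entropy_at (H : submodClosed M) : \bar K :=
  limn (fun n : nat => (L (subquotient (trajectory n H) H) * (n%:R^-1)%:E)%E).

Definition intrinsic_entropy : \bar K :=
  ereal_sup [set intrinsic_entropy_at H | H in inert].

End Entropy.

(* The R-module underlying an R[X]-module. *)
Definition res_module (R : nzRingType) (M : lmodType {poly R}) : Type := M.

Section Restriction.
Variables (R : nzRingType) (M : lmodType {poly R}).

HB.instance Definition _ := GRing.Zmodule.on (res_module M).

Definition res_scale (a : R) (x : res_module M) : res_module M :=
  a%:P *: (x : M).

Lemma res_scalerA a b x : res_scale a (res_scale b x) = res_scale (a * b) x.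
Proof. by rewrite /res_scale scalerA polyCM. Qed.

Lemma res_scale1r : left_id 1 res_scale.
Proof. by move=> x; rewrite /res_scale scale1r. Qed.

Lemma res_scalerDr : right_distributive res_scale +%R.
Proof. by move=> a x y; rewrite /res_scale scalerDr. Qed.

Lemma res_scalerDl x : {morph res_scale^~ x : a b / a + b}.
Proof. by move=> a b; rewrite /res_scale polyCD scalerDl. Qed.

HB.instance Definition _ := GRing.Zmodule_isLmodule.Build R (res_module M)
  res_scalerA res_scale1r res_scalerDr res_scalerDl.

Definition mulX (x : res_module M) : res_module M := 'X *: (x : M).

Lemma mulX_is_linear : linear mulX.
Proof.
move=> a x y; rewrite /mulX scalerDr; congr (_ + _).
by rewrite [LHS]scalerA -commr_polyX -scalerA.
Qed.

HB.instance Definition _ :=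
  GRing.isLinear.Build R (res_module M) (res_module M) _ mulX mulX_is_linear.

End Restriction.

Definition intrinsic_valuation_entropy (K : realType) (R : nzRingType)
    (L : lmodType R -> \bar K) (M : lmodType {poly R}) : \bar K :=
  intrinsic_entropy L (@mulX R M).

(* Main.v *)
Require Import Defs.
From HB Require Import structures.
From mathcomp Require Import all_boot all_order all_algebra.
From mathcomp Require Import fraction.
From mathcomp Require Import all_classical all_reals all_analysis.
Import numFieldNormedType.Exports.
Import Order.TTheory GRing.Theory Num.Theory.

Set Implicit Arguments.
Unset Strict Implicit.
Unset Printing Implicit Defensive.

Local Open Scope classical_set_scope.
Local Open Scope ring_scope.

(** Write T_n(H) = H + phi H + ... + phi^(n-1) H. The map phi^n induces a surjection of H onto
    T_(n+1)(H) / T_n(H), whose kernel H_n consists of the h in H with phi^n h in T_n(H). These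
    kernels increase with n; let H_oo be their union ([absorbed phi H]). When H is inert, L(H / H_1)
    is finite and upper continuity of L makes L(H / H_n) converge to L(H / H_oo); taking means, the
    entropy of phi at H is L(H / H_oo) ([intrinsic_entropy_atE]). This expression has no limit in
    it and is defined for all H; it is called [residual] below.

    The main step is that the entropy of phi is the supremum of [residual] over all finitely
    generated submodules A, inert or not ([entropy_le], [residual_le_entropy]). One bound is upper
    continuity of L. For the other, suppose first that each x satisfies r phi^n x in T_n(Rx) for
    some n and some r <> 0. Then the same holds for A with a common n and r, so
    T_(n+1)(A) / T_n(A) is finitely generated and torsion; such modules have finite length because
    L(R / I) is finite for I <> 0. Hence T_n(A) is inert, and it has the same residual length as A
    ([residual_traj]). If on the contrary some x generates a free R[X]-module, the inert submodules
    Rx + r R[X]x have residual length at least v(r), and the entropy is infinite.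

    Invariance and upper continuity follow, since residual lengths of finitely generated submodules
    are preserved by embeddings. Let V' -> V -> V'' be exact. If A is finitely generated in V,
    the residual length of A is that of its image in V'' plus a term which upper continuity
    compares with residual lengths of finitely generated submodules of V'
    ([entropy_extension_le]). For the converse inequality, finitely generated submodules of
    V' and V'' are combined into a submodule of V, and the lengths of the trajectories are
    compared up to a constant, the length of the torsion of a finitely generated module; the
    constant vanishes in the mean ([entropy_extension_ge]). *)

(** * Submodules and their generators *)

Section SubmoduleOps.
Variables (S : pzRingType) (V : lmodType S).
Implicit Types (A B : submodClosed V) (s : seq V).

Lemma in_mk_submod (P : set V) hP x : (x \in @mk_submod S V P hP) = `[< P x >] :> bool.
Proof. by []. Qed.

Lemma mk_submodP (P : set V) hP x : (x \in @mk_submod S V P hP) <-> P x.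
Proof. by rewrite in_mk_submod; split => /asboolP. Qed.

Lemma memN A x : x \in A -> - x \in A.
Proof. by move=> xA; rewrite -scaleN1r rpredZ. Qed.

Lemma memB A x y : x \in A -> y \in A -> x - y \in A.
Proof. by move=> xA yA; rewrite rpredD // memN. Qed.

Lemma submod_zeroP x : x \in submod_zero V <-> x = 0.
Proof. exact: mk_submodP. Qed.

Lemma submod_addP A B x :
  x \in submod_add A B <-> exists a b, [/\ a \in A, b \in B & x = a + b].
Proof. exact: mk_submodP. Qed.

Lemma submod_cap_subproof A B : subsemimod_closed
  (fun x : V => `[< x \in A /\ x \in B >]).
Proof.
split; first split.
- by apply/asboolP; rewrite !rpred0.
- by move=> x y /asboolP[? ?] /asboolP[? ?]; apply/asboolP; rewrite !rpredD.
- by move=> a x /asboolP[? ?]; apply/asboolP; rewrite !rpredZ.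
Qed.

Definition submod_cap A B : submodClosed V := mk_submod (submod_cap_subproof A B).

Lemma submod_capP A B x : x \in submod_cap A B <-> x \in A /\ x \in B.
Proof. exact: mk_submodP. Qed.

Definition lincomb s (x : V) : Prop :=
  exists c : 'I_(size s) -> S, x = \sum_(i < size s) c i *: s`_i.

Lemma lincomb_cons y s x :
  lincomb (y :: s) x <-> exists a z, lincomb s z /\ x = a *: y + z.
Proof.
split=> [[c ->]|[a [z [[c ->] ->]]]].
  rewrite big_ord_recl /=; exists (c ord0), (\sum_(i < size s) c (lift ord0 i) *: s`_i).
  by split=> //; exists (fun i => c (lift ord0 i)).
exists (fun i => oapp c a (unlift ord0 i)).
rewrite big_ord_recl /= unlift_none; congr (_ + _).
by apply: eq_bigr => i _; rewrite liftK.
Qed.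

Lemma lincomb_nil x : lincomb [::] x <-> x = 0.
Proof.
by split=> [[c ->]|->]; [rewrite big_ord0|exists (fun=> 0); rewrite big_ord0].
Qed.

Lemma span_subproof s : subsemimod_closed (fun x : V => `[< lincomb s x >]).
Proof.
split; first split.
- by apply/asboolP; exists (fun=> 0); rewrite big1 // => i _; rewrite scale0r.
- move=> _ _ /asboolP[c ->] /asboolP[d ->]; apply/asboolP.
  exists (fun i => c i + d i); rewrite -big_split /=.
  by apply: eq_bigr => i _; rewrite scalerDl.
- move=> a _ /asboolP[c ->]; apply/asboolP; exists (fun i => a * c i).
  by rewrite scaler_sumr; apply: eq_bigr => i _; rewrite scalerA.
Qed.

Definition span_of s : submodClosed V := mk_submod (span_subproof s).

Lemma span_ofP s x : x \in span_of s <-> lincomb s x.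
Proof. exact: mk_submodP. Qed.

Lemma span_consP y s x :
  x \in span_of (y :: s) <-> exists a z, z \in span_of s /\ x = a *: y + z.
Proof.
rewrite span_ofP lincomb_cons; split=> -[a [z [zs ->]]]; exists a, z; split=> //.
  exact/span_ofP.
exact/span_ofP.
Qed.

Lemma span_nilP x : x \in span_of [::] <-> x = 0.
Proof. by rewrite span_ofP lincomb_nil. Qed.

Lemma mem_span s y : y \in s -> y \in span_of s.
Proof.
elim: s => // z s IH; rewrite inE => /orP[/eqP ->|/IH ys]; apply/span_consP.
  by exists 1, 0; rewrite rpred0 scale1r addr0.
by exists 0, y; rewrite scale0r add0r.
Qed.

Lemma span_sub s A : {in s, forall y, y \in A} -> {subset span_of s <= A}.
Proof.
elim: s => [_ x /span_nilP -> | y s IH sA x /span_consP[a [z [zs ->]]]].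
  exact: rpred0.
have sA' : {in s, forall y, y \in A} by move=> t ts; apply: sA; rewrite inE ts orbT.
by rewrite rpredD //; [rewrite rpredZ // sA ?mem_head|exact: IH sA' z zs].
Qed.

Lemma fg_span s : finitely_generated (span_of s).
Proof. by exists s => x; rewrite span_ofP. Qed.

Lemma fgP A : finitely_generated A <-> exists s, A =i span_of s.
Proof.
split=> [[s sA]|[s As]]; exists s => x; last by rewrite As; exact: span_ofP.
by apply/idP/idP => /=; [move=> /sA /span_ofP|move=> /span_ofP /sA].
Qed.

Lemma span_cat s t : span_of (s ++ t) =i submod_add (span_of s) (span_of t).
Proof.
move=> x; apply/idP/idP => [|/submod_addP[a [b [aA bB ->]]]].
  apply: (@span_sub _ (submod_add _ _)) => y; rewrite mem_cat => /orP[] /mem_span ys.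
    by apply/submod_addP; exists y, 0; rewrite ys rpred0 addr0.
  by apply/submod_addP; exists 0, y; rewrite ys rpred0 add0r.
rewrite rpredD //.
  by move: a aA; apply: span_sub => y ys; apply: mem_span; rewrite mem_cat ys.
by move: b bB; apply: span_sub => y ys; apply: mem_span; rewrite mem_cat ys orbT.
Qed.

End SubmoduleOps.

Section Maps.
Variables (S : pzRingType) (V W : lmodType S) (f : {linear V -> W}).
Implicit Types (A : submodClosed V) (B : submodClosed W).

Lemma submod_imageP A y : y \in submod_image f A <-> exists2 x, x \in A & y = f x.
Proof. exact: mk_submodP. Qed.

Lemma submod_preimageP B (x : V) : x \in submod_preimage f B <-> f x \in B.
Proof. exact: mk_submodP. Qed.

Lemma mem_image A (x : V) : x \in A -> f x \in submod_image f A.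
Proof. by move=> xA; apply/submod_imageP; exists x. Qed.

Lemma image_span s : submod_image f (span_of s) =i span_of (map f s).
Proof.
move=> y; apply/idP/idP.
  move/submod_imageP => [x xs ->]; apply/submod_preimageP; move: x xs.
  apply: span_sub => x xs; apply/submod_preimageP; apply: mem_span.
  exact: map_f.
move: y; apply: span_sub => _ /mapP[x xs ->]; apply: mem_image.
exact: mem_span.
Qed.

End Maps.

(** * Subquotients and their representatives *)

Section Quotients.
Variables (S : pzRingType) (V : lmodType S).
Implicit Types (A B C : submodClosed V).

Lemma quot_proj_linear A : linear (@quot_proj S V A).
Proof.
by move=> a x y; rewrite quot_projD; congr (_ + _); rewrite -quot_scaleE.
Qed.

HB.instance Definition _ A :=
  GRing.isLinear.Build S V (quot_module A) _ (@quot_proj S V A) (@quot_proj_linear A).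

Definition quot_linear A : {linear V -> quot_module A} := quot_proj A.

Lemma quot_proj0P A x : quot_proj A x = 0 <-> x \in A.
Proof.
rewrite -(linear0 (quot_proj A)); split=> [/eqP|xA]; last apply/eqP;
by rewrite quot_proj_eq subr0.
Qed.

End Quotients.

Section Subquotients.
Variables (S : pzRingType) (V : lmodType S).
Implicit Types (A B C : submodClosed V).

Definition sqproj A B : {linear submod_type A -> subquotient A B} :=
  quot_linear (submod_preimage (\val : {linear submod_type A -> V}) B).

Lemma sqproj_surj A B (q : subquotient A B) : exists a, q = sqproj A B a.
Proof. exact: quot_projP. Qed.

Lemma sqproj0P A B (a : submod_type A) : sqproj A B a = 0 <-> \val a \in B.
Proof.
split=> [/quot_proj0P/submod_preimageP //|aB].
by apply/quot_proj0P/submod_preimageP.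
Qed.

(** Elements of a subquotient are handled through representatives in the ambient
    module, which turns maps between subquotients into relations. *)
Definition sqrep A B (x : V) (q : subquotient A B) : Prop :=
  exists a : submod_type A, x = \val a /\ q = sqproj A B a.

Lemma sqrep_surj A B (q : subquotient A B) : exists x, sqrep x q.
Proof. by have [a ->] := sqproj_surj q; exists (\val a), a. Qed.

Lemma sqrep_ex A B x : x \in A -> exists q : subquotient A B, sqrep x q.
Proof. by move=> xA; exists (sqproj A B (SubmodElt xA)), (SubmodElt xA). Qed.

Lemma sqrep_mem A B x (q : subquotient A B) : sqrep x q -> x \in A.
Proof. by move=> [a [-> _]]; exact: valP. Qed.

Lemma sqrep_lin A B c x y (p q : subquotient A B) :
  sqrep x p -> sqrep y q -> sqrep (c *: x + y) (c *: p + q).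
Proof.
move=> [a [-> ->]] [b [-> ->]]; exists (c *: a + b); split.
  exact: esym (linearP (\val : {linear submod_type A -> V}) c a b).
by rewrite linearP.
Qed.

Lemma sqrep0 A B x : sqrep x (0 : subquotient A B) <-> x \in A /\ x \in B.
Proof.
split=> [xr|[xA xB]].
  split; first exact: sqrep_mem xr.
  by case: xr => a [-> /esym/sqproj0P].
exists (SubmodElt xA); split=> //.
by apply/esym/sqproj0P.
Qed.

End Subquotients.

(** * Comparing lengths along linear relations *)

Section LinearRelations.
Variables (S : pzRingType).

Definition linear_rel (U W : lmodType S) (r : U -> W -> Prop) : Prop :=
  forall (a : S) x y x' y', r x y -> r x' y' -> r (a *: x + x') (a *: y + y').

Variables (U W : lmodType S) (r : U -> W -> Prop).
Hypothesis r_lin : linear_rel r.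

Lemma linear_rel0 x y : r x y -> r 0 0.
Proof. by move=> h; have := r_lin (-1) h h; rewrite !scaleN1r !addNr. Qed.

Lemma linear_relD x y x' y' : r x y -> r x' y' -> r (x + x') (y + y').
Proof. by move=> h h'; have := r_lin 1 h h'; rewrite !scale1r. Qed.

Lemma linear_relZ a x y : r x y -> r (a *: x) (a *: y).
Proof. by move=> h; have := r_lin a h (linear_rel0 h); rewrite !addr0. Qed.

Lemma linear_relB x y x' y' : r x y -> r x' y' -> r (x - x') (y - y').
Proof.
by move=> h h'; have := r_lin (-1) h' h; rewrite !scaleN1r ![- _ + _]addrC.
Qed.

(** This is how linear maps are produced below: it is enough to describe a
    correspondence that is total and takes only the value 0 at 0. *)
Lemma linear_of_rel : (forall x, exists y, r x y) -> (forall y, r 0 y -> y = 0) ->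
  exists f : {linear U -> W}, forall x y, r x y <-> y = f x.
Proof.
move=> tot sv; have [f fP] := choice tot.
have fE x y : r x y -> y = f x.
  move=> rxy; apply/eqP; rewrite -subr_eq0; apply/eqP/sv.
  by have := linear_relB rxy (fP x); rewrite subrr.
have f_lin : linear f by move=> a x y; apply/esym/fE; apply: r_lin.
pose g : {linear U -> W} := HB.pack f (GRing.isLinear.Build _ _ _ _ f f_lin).
by exists g => x y; split=> [/fE //|->]; apply: fP.
Qed.

End LinearRelations.

Section LengthCalculus.
Variables (K : realType) (S : pzRingType) (L : lmodType S -> \bar K).
Hypothesis hL : length_function L.
Local Open Scope ereal_scope.

(** No inclusion is required: this is the length of A / (A /\ B), which is also that of
    (A + B) / B. *)
Definition sqlen (V : lmodType S) (A B : submodClosed V) : \bar K :=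
  L (subquotient A B).

Let L_ge0 M : 0 <= L M. Proof. exact: length_ge0. Qed.

Lemma sqlen_ge0 (V : lmodType S) (A B : submodClosed V) : 0 <= sqlen A B.
Proof. exact: L_ge0. Qed.

Lemma short_exact_rel (M' M M'' : lmodType S)
    (r : M' -> M -> Prop) (t : M -> M'' -> Prop) :
  linear_rel r -> linear_rel t ->
  (forall x, exists y, r x y) -> (forall y, r 0%R y -> y = 0%R) ->
  (forall x, r x 0%R -> x = 0%R) ->
  (forall y, exists z, t y z) -> (forall z, exists y, t y z) ->
  (forall z, t 0%R z -> z = 0%R) ->
  (forall y, t y 0%R <-> exists x, r x y) ->
  L M = L M' + L M''.
Proof.
move=> rl tl rt rs ri tt to ts ex.
have [f fP] := linear_of_rel rl rt rs.
have [g gP] := linear_of_rel tl tt ts.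
apply: (length_additive hL (f := f) (g := g)); split.
- move=> x y fxy; apply/eqP; rewrite -subr_eq0; apply/eqP/ri/fP.
  by rewrite linearB fxy subrr.
- move=> y; rewrite -[g y = _]/(_) ; split.
    by move=> gy; have /ex[x /fP ->] : t y 0%R by [apply/gP]; exists x.
  by move=> [x fx]; apply/esym/gP/ex; exists x; apply/fP.
- by move=> z; have [y /gP ->] := to z; exists y.
Qed.

(** The domain of r is a submodule D of U, and r induces a surjection of D onto W; so W
    is a subquotient of U, and additivity bounds its length. Every comparison of lengths
    below is an instance of this. *)
Lemma length_subquot (U W : lmodType S) (r : U -> W -> Prop) :
  linear_rel r -> (forall y, exists x, r x y) -> (forall y, r 0%R y -> y = 0%R) ->
  L W <= L U.
Proof.
move=> rl ro rs.
have dP : subsemimod_closed (fun x : U => `[< exists y, r x y >]).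
  split; first split.
  - by apply/asboolP; have [x /(linear_rel0 rl)] := ro 0%R; exists 0%R.
  - move=> x y /asboolP[x' rx] /asboolP[y' ry]; apply/asboolP.
    by exists (x' + y')%R; apply: linear_relD.
  - move=> a x /asboolP[x' rx]; apply/asboolP; exists (a *: x')%R.
    exact: linear_relZ.
pose D := mk_submod dP.
have kP : subsemimod_closed (fun x : submod_type D => `[< r (\val x) 0%R >]).
  have valP' a (x y : submod_type D) :
    (\val (a *: x + y) = a *: (\val x) + \val y)%R.
    exact: (linearP (\val : {linear submod_type D -> U})).
  have v0 : \val (0 : submod_type D)%R = 0%R.
    exact: (linear0 (\val : {linear submod_type D -> U})).
  split; first split.
  - by apply/asboolP; rewrite v0; have [x /(linear_rel0 rl)] := ro 0%R.
  - move=> x y /asboolP rx /asboolP ry; apply/asboolP.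
    rewrite -[x]scale1r valP' scale1r -[0%R](addr0 0%R).
    exact: linear_relD.
  - move=> a x /asboolP rx; apply/asboolP.
    rewrite -[(a *: x)%R]addr0 valP' v0 addr0 -[0%R](scaler0 _ a).
    exact: linear_relZ.
have E1 : L (submod_type D) = L (submod_type (mk_submod kP)) + L W.
  apply: (@short_exact_rel _ _ _ (fun x y => y = \val x)
    (fun (y : submod_type D) z => r (\val y) z)).
  - move=> a x y x' y' -> ->; apply/esym.
    exact: (linearP (\val : {linear submod_type (mk_submod kP) -> submod_type D})).
  - move=> a x y x' y' rx ry.
    rewrite [\val _](linearP (\val : {linear submod_type D -> U})); exact: rl.
  - by move=> x; exists (\val x).
  - move=> _ ->.
    exact: (linear0 (\val : {linear submod_type (mk_submod kP) -> submod_type D})).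
  - move=> x x0; apply: val_inj; rewrite -x0; apply/esym.
    exact: (linear0 (\val : {linear submod_type (mk_submod kP) -> submod_type D})).
  - by move=> y; have /mk_submodP := valP y.
  - move=> z; have [y ryz] := ro z.
    have yD : y \in D by apply/mk_submodP; exists z.
    by exists (SubmodElt yD).
  - move=> z; rewrite (linear0 (\val : {linear submod_type D -> U})); exact: rs.
  - move=> y; split=> [ry|[x ->]]; last by have /mk_submodP := valP x.
    have yk : y \in mk_submod kP by apply/mk_submodP.
    by exists (SubmodElt yk).
have E2 : L U = L (submod_type D) + L (quot_module D).
  apply: (@short_exact_rel _ _ _ (fun x y => y = \val x)
    (fun (y : U) z => z = quot_proj D y)).
  - move=> a x y x' y' -> ->; apply/esym.
    exact: (linearP (\val : {linear submod_type D -> U})).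
  - by move=> a x y x' y' -> ->; apply/esym; apply: (linearP (quot_linear D)).
  - by move=> x; exists (\val x).
  - move=> _ ->; exact: (linear0 (\val : {linear submod_type D -> U})).
  - move=> x x0; apply: val_inj; rewrite -x0; apply/esym.
    exact: (linear0 (\val : {linear submod_type D -> U})).
  - by move=> y; eexists.
  - exact: quot_projP.
  - move=> _ ->; exact: (linear0 (quot_linear D)).
  - move=> y; split=> [/esym/quot_proj0P yD|[x ->]]; first by exists (SubmodElt yD).
    by apply/esym/quot_proj0P/valP.
rewrite E2 E1; apply: (le_trans _ (leeDl _ _)) => //.
exact: leeDr.
Qed.

Lemma sqrep_eq0 (V : lmodType S) (A B : submodClosed V) (x : V) (q : subquotient A B) : sqrep x q -> x \in B -> q = 0%R.
Proof. by move=> [a [-> ->]] aB; apply/sqproj0P. Qed.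

(** The working form of [length_subquot]: r need be neither functional nor total, as long
    as it reaches every element of A' from A and carries A /\ B into B'. *)
Lemma sqlen_rel (V W : lmodType S) (A B : submodClosed V) (A' B' : submodClosed W)
    (r : V -> W -> Prop) :
  linear_rel r ->
  (forall y, y \in A' -> exists2 x, x \in A & r x y) ->
  (forall x y, x \in A -> x \in B -> y \in A' -> r x y -> y \in B') ->
  sqlen A' B' <= sqlen A B.
Proof.
move=> rl ro rk.
apply: (@length_subquot _ _ (fun p q => exists x y, [/\ sqrep x p, sqrep y q & r x y])).
- move=> a p q p' q' [x [y [xp yq rxy]]] [x' [y' [xp' yq' rxy']]].
  by exists (a *: x + x')%R, (a *: y + y')%R; split; [exact: sqrep_lin..|exact: rl].
- move=> q; have [y yq] := sqrep_surj q.
  have [x xA rxy] := ro y (sqrep_mem yq).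
  by have [p xp] := sqrep_ex B xA; exists p, x, y.
- move=> q [x [y [/sqrep0[xA xB] yq rxy]]].
  by apply: sqrep_eq0 (yq) _; apply: rk rxy => //; exact: sqrep_mem yq.
Qed.

Lemma sqlen_mono (V : lmodType S) (A B A' B' : submodClosed V) :
  {subset A' <= A} -> (forall x, x \in A' -> x \in B -> x \in B') ->
  sqlen A' B' <= sqlen A B.
Proof.
move=> sA sB; apply: (@sqlen_rel _ _ _ _ _ _ (fun x y => x = y)).
- by move=> a x y x' y' -> ->.
- by move=> y yA; exists y => //; exact: sA.
- by move=> x y _ xB yA xy; apply: sB => //; rewrite -xy.
Qed.

Lemma sqlen_eq0 (V : lmodType S) (A B : submodClosed V) :
  {subset A <= B} -> sqlen A B = 0.
Proof.
move=> sAB; apply: (length_invariant hL).1 => q.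
by have [x xq] := sqrep_surj q; apply: sqrep_eq0 (xq) _; exact/sAB/(sqrep_mem xq).
Qed.

(** Additivity for A / (A /\ C) filtered by A /\ B, which contains A /\ C by hypothesis. *)
Lemma sqlen_add (V : lmodType S) (A B C : submodClosed V) :
  (forall x, x \in A -> x \in C -> x \in B) ->
  sqlen A C = sqlen A B + sqlen (submod_cap A B) C.
Proof.
move=> sCB; rewrite addeC.
apply: (@short_exact_rel _ _ _
  (fun p q => exists2 x, sqrep x p & sqrep x q)
  (fun p q => exists2 x, sqrep x p & sqrep x q)).
- move=> a p q p' q' [x xp xq] [x' xp' xq'].
  by exists (a *: x + x')%R; exact: sqrep_lin.
- move=> a p q p' q' [x xp xq] [x' xp' xq'].
  by exists (a *: x + x')%R; exact: sqrep_lin.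
- move=> p; have [x xp] := sqrep_surj p.
  have /submod_capP[xA _] := sqrep_mem xp.
  by have [q xq] := sqrep_ex C xA; exists q, x.
- by move=> q [x /sqrep0[_ xC] xq]; exact: sqrep_eq0 xq xC.
- by move=> q [x xq /sqrep0[_ xC]]; exact: sqrep_eq0 xq xC.
- move=> p; have [x xp] := sqrep_surj p.
  by have [q xq] := sqrep_ex B (sqrep_mem xp); exists q, x.
- move=> p; have [x xp] := sqrep_surj p.
  by have [q xq] := sqrep_ex C (sqrep_mem xp); exists q, x.
- move=> q [x /sqrep0[xA xC] xq]; apply: sqrep_eq0 xq _; exact: sCB.
- move=> p; split=> [[x xp /sqrep0[xA xB]]|[q [x xq xp]]].
    have /(sqrep_ex C)[q xq] : x \in submod_cap A B by apply/submod_capP.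
    by exists q, x.
  by exists x => //; apply/sqrep0; have /submod_capP := sqrep_mem xq.
Qed.

(** Upper continuity for subquotients: generators of a finitely generated submodule of
    A / (A /\ B) lift to A. *)
Lemma sqlen_upper (V : lmodType S) (A B : submodClosed V) c :
  (forall s, {subset span_of s <= A} -> sqlen (span_of s) B <= c) -> sqlen A B <= c.
Proof.
move=> h; rewrite /sqlen (length_upper_continuous hL).
apply: ge_ereal_sup => _ [F [qs Fqs] <-].
have [ss [sA ssP]] : exists ss : seq V, {subset span_of ss <= A} /\
    forall q, lincomb qs q -> exists2 x, x \in span_of ss & @sqrep _ _ A B x q.
  elim: qs {F Fqs} => [|q qs [ss [sA ssP]]].
    exists [::]; split=> [x /span_nilP ->|q]; first exact: rpred0.
    move/lincomb_nil=> ->; exists 0%R; first exact: rpred0.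
    by apply/sqrep0; rewrite !rpred0.
  have [x xq] := sqrep_surj q.
  exists (x :: ss); split=> [y /span_consP[a [z [/sA zA ->]]]|p].
    by rewrite rpredD ?rpredZ // (sqrep_mem xq).
  move/lincomb_cons=> [a [p' [/ssP[z zs zp'] ->]]].
  exists (a *: x + z)%R; first by apply/span_consP; exists a, z.
  exact: sqrep_lin.
apply: le_trans (h ss sA).
apply: (@length_subquot _ _ (fun p w => exists2 x, sqrep x p & sqrep x (\val w))).
- move=> a p q p' q' [x xp xq] [x' xp' xq'].
  exists (a *: x + x')%R; first exact: sqrep_lin.
  rewrite [\val _](linearP (\val : {linear submod_type F -> _})).
  exact: sqrep_lin.
- move=> w; have /Fqs/ssP[x xs xw] := valP w.
  by have [p xp] := sqrep_ex B xs; exists p, x.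
- move=> w [x /sqrep0[_ xB] xw]; apply: val_inj.
  rewrite [RHS](linear0 (\val : {linear submod_type F -> _})).
  exact: sqrep_eq0 xw xB.
Qed.

End LengthCalculus.

(** * Trajectories *)

Section Trajectories.
Variables (R : pzRingType) (V : lmodType R) (phi : {linear V -> V}).
Implicit Types (A B H : submodClosed V).

Local Notation T := (trajectory phi).

Lemma big_submod_addP n (F : 'I_n -> submodClosed V) x :
  x \in \big[@submod_add R V/submod_zero V]_(i < n) F i <->
  exists2 h : 'I_n -> V, forall i, h i \in F i & x = \sum_(i < n) h i.
Proof.
elim: n F x => [|n IH] F x.
  rewrite big_ord0 submod_zeroP; split=> [->|[h _]]; last by rewrite big_ord0.
  by exists (fun=> 0); [case|rewrite big_ord0].
rewrite big_ord_recl submod_addP; split.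
  move=> [a [b [aF /IH[h hF ->] ->]]]; exists (fun i => oapp h a (unlift ord0 i)).
    by move=> i; case: unliftP => [j ->|->] /=.
  rewrite big_ord_recl unlift_none; congr (_ + _).
  by apply: eq_bigr => i _; rewrite liftK.
move=> [h hF ->]; rewrite big_ord_recl; exists (h ord0), (\sum_(i < n) h (lift ord0 i)).
by split=> //; apply/IH; exists (fun i => h (lift ord0 i)).
Qed.

Lemma iter_imageP i H y :
  y \in iter i (submod_image phi) H <-> exists2 x, x \in H & y = iter i phi x.
Proof.
elim: i y => [|i IH] y /=; first by split=> [yH|[x xH ->]] //; exists y.
rewrite submod_imageP; split=> [[z /IH[x xH ->] ->]|[x xH ->]]; first by exists x.
by exists (iter i phi x) => //; apply/IH; exists x.
Qed.

Lemma mem_traj n H i h : (i < n)%N -> h \in H -> iter i phi h \in T n H.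
Proof.
move=> lt_in hH; apply/big_submod_addP.
exists (fun j : 'I_n => if j == Ordinal lt_in then iter i phi h else 0).
  move=> j; case: eqP => [->|_]; last exact: rpred0.
  by apply/iter_imageP; exists h.
rewrite (bigD1 (Ordinal lt_in)) //= eqxx big1 ?addr0 // => j /negPf -> //.
Qed.

Lemma traj_sub n H A :
  (forall i h, (i < n)%N -> h \in H -> iter i phi h \in A) -> {subset T n H <= A}.
Proof.
move=> hA x /big_submod_addP[h hH ->]; apply: rpred_sum => i _.
by have /iter_imageP[y yH ->] := hH i; apply: hA.
Qed.

Lemma traj_mono m n H H' : (m <= n)%N -> {subset H <= H'} -> {subset T m H <= T n H'}.
Proof.
move=> le_mn sH; apply: traj_sub => i h lt_im /sH hH'.
by apply: mem_traj => //; exact: leq_trans le_mn.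
Qed.

Lemma traj1 H : T 1 H =i H.
Proof.
move=> x; apply/idP/idP => [|xH]; last exact: (@mem_traj 1 H 0).
by move: x; apply: traj_sub => -[].
Qed.

Lemma traj_sup n H : (0 < n)%N -> {subset H <= T n H}.
Proof. by move=> n0 x xH; apply: (@mem_traj n H 0). Qed.

Lemma trajSP n H x :
  x \in T n.+1 H <-> exists t h, [/\ t \in T n H, h \in H & x = t + iter n phi h].
Proof.
split=> [|[t [h [tT hH ->]]]]; last first.
  by rewrite rpredD ?mem_traj //; apply: traj_mono tT.
move=> xT; suff : x \in submod_add (T n H) (iter n (submod_image phi) H).
  move=> /submod_addP[t [_ [tT /iter_imageP[h hH ->] ->]]].
  by exists t, h.
move: x xT; apply: traj_sub => i h; rewrite ltnS leq_eqVlt => /orP[/eqP ->|lt_in] hH.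
  apply/submod_addP; exists 0, (iter n phi h); rewrite rpred0 add0r; split=> //.
  by apply/iter_imageP; exists h.
apply/submod_addP; exists (iter i phi h), 0; rewrite rpred0 addr0; split=> //.
exact: mem_traj.
Qed.

Lemma iter_linear i : linear (iter i phi).
Proof. by elim: i => [|i IH] a x y //=; rewrite IH linearP. Qed.

Lemma iter_linD i x y : iter i phi (x + y) = iter i phi x + iter i phi y.
Proof. by have := iter_linear i 1 x y; rewrite !scale1r. Qed.

Lemma iter_lin0 i : iter i phi 0 = 0.
Proof. by elim: i => //= i ->; rewrite linear0. Qed.

Lemma iter_linZ i a x : iter i phi (a *: x) = a *: iter i phi x.
Proof. by have := iter_linear i a x 0; rewrite iter_lin0 !addr0. Qed.

Lemma iter_traj k n H x : x \in T n H -> iter k phi x \in T (k + n) H.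
Proof.
move=> /big_submod_addP[h hH ->].
elim/big_rec: _ => [|i y _ IH]; first by rewrite iter_lin0 rpred0.
rewrite iter_linD rpredD //; have /iter_imageP[z zH ->] := hH i.
by rewrite -iterD mem_traj // ltn_add2l.
Qed.

(** Replacing H by one of its trajectories only shifts the sequence of trajectories; this
    allows a non-inert module to be replaced by an inert one at no cost. *)
Lemma traj_traj n k H : T n.+1 (T k.+1 H) =i T (n + k).+1 H.
Proof.
move=> x; apply/idP/idP; move: x; apply: traj_sub => i h.
  rewrite ltnS => le_in hT; apply: (@traj_mono (i + k.+1) _ H) => //.
    by rewrite addnS ltnS leq_add2r.
  exact: iter_traj.
rewrite ltnS => le_i hH; have [le_in|lt_ni] := leqP i n.
  by apply: mem_traj => //; apply: traj_sup.
rewrite -(subnKC (ltnW lt_ni)) iterD.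
apply: mem_traj => //; apply: mem_traj => //.
by rewrite ltnS leq_subLR.
Qed.

Lemma traj_fg n H : finitely_generated H -> finitely_generated (T n H).
Proof.
move=> /fgP[s Hs]; apply/fgP; elim: n => [|n [t IH]].
  exists [::] => x; rewrite /trajectory big_ord0.
  by apply/idP/idP => [/submod_zeroP ->|/span_nilP ->]; rewrite rpred0.
exists (t ++ map (iter n phi) s) => x; rewrite span_cat.
have im y : y \in iter n (submod_image phi) H <-> y \in span_of (map (iter n phi) s).
  pose f : {linear V -> V} :=
    HB.pack (iter n phi) (GRing.isLinear.Build _ _ _ _ (iter n phi) (iter_linear n)).
  have := image_span f s y; rewrite iter_imageP => <-.
  by split=> [[z zH ->]|/submod_imageP[z zs ->]]; [apply/submod_imageP; exists z; rewrite -?Hs|exists z; rewrite ?Hs].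
apply/idP/idP => [/trajSP[a [b [aT bH ->]]]|/submod_addP[a [b [aT /im bs ->]]]].
  apply/submod_addP; exists a, (iter n phi b); split=> //; first by rewrite -IH.
  by apply/im/iter_imageP; exists b.
move/iter_imageP: bs => [h hH ->].
by apply/trajSP; exists a, h; rewrite IH.
Qed.

End Trajectories.

Section TrajectoryImage.
Variables (R : pzRingType) (V W : lmodType R).
Variables (phi : {linear V -> V}) (psi : {linear W -> W}) (f : {linear V -> W}).
Hypothesis fC : forall x, f (phi x) = psi (f x).

Lemma iterC i x : f (iter i phi x) = iter i psi (f x).
Proof. by elim: i => //= i <-; rewrite fC. Qed.

Lemma traj_image n H :
  trajectory psi n (submod_image f H) =i submod_image f (trajectory phi n H).
Proof.
move=> x; apply/idP/idP; move: x.
  apply: traj_sub => i _ lt_in /submod_imageP[x xH ->]; rewrite -iterC.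
  by apply: mem_image; apply: mem_traj.
move=> _ /submod_imageP[x xT ->]; apply/(submod_preimageP f).
move: x xT; apply: traj_sub => i h lt_in hH; apply/submod_preimageP.
by rewrite iterC mem_traj // mem_image.
Qed.

End TrajectoryImage.

(** * The absorbed part of a submodule *)

Section Absorbed.
Variables (R : pzRingType) (V : lmodType R) (phi : {linear V -> V}).
Implicit Types (A B H : submodClosed V).
Local Notation T := (trajectory phi).

Lemma recur_step H n m h : (n <= m)%N -> iter n phi h \in T n H -> iter m phi h \in T m H.
Proof.
by move=> le_nm hT; rewrite -(subnK le_nm) iterD; apply: iter_traj.
Qed.

Lemma absorbed_at_subproof n H : subsemimod_closed
  (fun h : V => `[< h \in H /\ iter n phi h \in T n H >]).
Proof.
split; first split.
- by apply/asboolP; rewrite iter_lin0 !rpred0.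
- move=> x y /asboolP[xH xT] /asboolP[yH yT]; apply/asboolP.
  by rewrite iter_linD !rpredD.
- by move=> a x /asboolP[xH xT]; apply/asboolP; rewrite iter_linZ !rpredZ.
Qed.

(** The kernel of the surjection from H onto T_(n+1)(H) / T_n(H) induced by phi^n. *)
Definition absorbed_at n H : submodClosed V := mk_submod (absorbed_at_subproof n H).

Lemma absorbed_atP n H h : h \in absorbed_at n H <-> h \in H /\ iter n phi h \in T n H.
Proof. exact: mk_submodP. Qed.

Lemma absorbed_subproof H : subsemimod_closed
  (fun h : V => `[< exists n, h \in absorbed_at n H >]).
Proof.
split; first split.
- by apply/asboolP; exists 0; exact: rpred0.
- move=> x y /asboolP[n /absorbed_atP[xH xn]] /asboolP[m /absorbed_atP[yH ym]].
  apply/asboolP; exists (maxn n m); apply/absorbed_atP; rewrite iter_linD !rpredD //.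
    exact: recur_step (leq_maxl _ _) xn.
  exact: recur_step (leq_maxr _ _) ym.
- move=> a x /asboolP[n xn]; apply/asboolP; exists n; exact: rpredZ.
Qed.

Definition absorbed H : submodClosed V := mk_submod (absorbed_subproof H).

Lemma absorbedP H h : h \in absorbed H <-> h \in H /\ exists n, iter n phi h \in T n H.
Proof.
rewrite mk_submodP; split=> [[n /absorbed_atP[hH hn]]|[hH [n hn]]]; first by split=> //; exists n.
by exists n; apply/absorbed_atP.
Qed.

Lemma absorbed_at_le n m H : (n <= m)%N -> {subset absorbed_at n H <= absorbed_at m H}.
Proof.
move=> le_nm h /absorbed_atP[hH hn]; apply/absorbed_atP; split=> //; exact: recur_step hn.
Qed.

(** The modules [absorbed_at n H] increase with n, so finitely many elements of their union
    lie in one of them; this is what makes upper continuity applicable. *)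
Lemma span_sub_absorbed s H : {subset span_of s <= absorbed H} ->
  exists n, {subset span_of s <= absorbed_at n H}.
Proof.
elim: s => [_|y s IH sT].
  by exists 0 => x /span_nilP ->; rewrite rpred0.
have [x xs|n sn] := IH.
  by apply: sT; apply/span_consP; exists 0, x; rewrite scale0r add0r.
have /mk_submodP[m ym] : y \in absorbed H by apply/sT/mem_span/mem_head.
exists (maxn n m) => x /span_consP[a [z [/sn zs ->]]].
rewrite rpredD ?rpredZ //; first exact: absorbed_at_le (leq_maxr _ _) _ ym.
exact: absorbed_at_le (leq_maxl _ _) _ zs.
Qed.

End Absorbed.

(** * A limit-free formula for the entropy at an inert submodule *)

Section Limit.
Variables (K : realType) (R : pzRingType) (L : lmodType R -> \bar K).
Hypothesis hL : length_function L.
Variables (V : lmodType R) (phi : {linear V -> V}).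
Implicit Types (A B H : submodClosed V).
Local Notation T := (trajectory phi).
Local Notation sqlen := (sqlen L).
Local Open Scope ereal_scope.

(** It equals the entropy at H when H is inert, but it makes sense for every H, and it
    involves no limit. *)
Definition residual H : \bar K := sqlen H (absorbed phi H).

Lemma residual_ge0 H : 0 <= residual H. Proof. exact: sqlen_ge0. Qed.

Lemma sqlen_ext (A B A' B' : submodClosed V) : A =i A' -> B =i B' ->
  sqlen A B = sqlen A' B'.
Proof.
move=> eA eB; apply/le_anti/andP; split; apply: sqlen_mono => // x.
- by rewrite eA.
- by rewrite eB.
- by rewrite eA.
- by rewrite eB.
Qed.

Lemma sqlen_step H n : sqlen (T n.+1 H) (T n H) = sqlen H (absorbed_at phi n H).
Proof.
pose r (x y : V) := (iter n phi x - y)%R \in T n H.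
have rP (a : R) x y x' y' : r x y -> r x' y' -> r (a *: x + x')%R (a *: y + y')%R.
  rewrite /r => rxy rxy'.
  rewrite iter_linear opprD addrACA -scalerBr.
  by rewrite rpredD // rpredZ.
apply/le_anti/andP; split.
  apply: (@sqlen_rel _ _ _ hL _ _ _ _ _ _ r) => //.
    move=> _ /trajSP[t [h [tT hH ->]]]; exists h => //.
    by rewrite /r opprD addrCA subrr addr0 memN.
  move=> x y xH /absorbed_atP[_ xT] yT; rewrite /r => xyT.
  by have := memB xT xyT; rewrite subKr.
apply: (@sqlen_rel _ _ _ hL _ _ _ _ _ _ (fun x y => r y x)).
- by move=> a x y x' y'; exact: rP.
- move=> h hH; exists (iter n phi h); first exact: mem_traj.
  by rewrite /r subrr rpred0.
- move=> x y _ xT yH; rewrite /r => yx; apply/absorbed_atP; split=> //.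
  by have := rpredD yx xT; rewrite subrK.
Qed.

Lemma sqlen_trajS H n : sqlen (T n.+2 H) H = sqlen H (absorbed_at phi n.+1 H) + sqlen (T n.+1 H) H.
Proof.
rewrite (@sqlen_add _ _ _ hL _ (T n.+2 H) (T n.+1 H) H); last by move=> x _; exact: traj_sup.
rewrite sqlen_step; congr (_ + _); apply: sqlen_ext => // x.
apply/idP/idP => [/submod_capP[]//|xT]; apply/submod_capP; split=> //.
by move: x xT; exact: traj_mono.
Qed.

Lemma inertP H : inert L phi H <-> sqlen H (absorbed_at phi 1 H) < +oo.
Proof.
rewrite /inert -/(sqlen _ _) -sqlen_step (@sqlen_ext _ _ (T 2 H) (T 1 H)) //.
  move=> x; apply/idP/idP => [/submod_addP|/trajSP].
    by move=> [a [_ [aH /submod_imageP[b bH ->] ->]]]; apply/trajSP; exists a, b; rewrite (traj1 phi).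
  move=> [a [b [aH bH ->]]]; apply/submod_addP; exists a, (phi b); rewrite -(traj1 phi); split=> //.
  exact: mem_image.
by move=> x; rewrite traj1.
Qed.

(** Since [absorbed phi H] is the union of the increasing modules [absorbed_at n H] and
    L(H / absorbed_at 1 H) is finite, the lengths of absorbed phi H / absorbed_at n H tend
    to 0: otherwise upper continuity would fail for absorbed phi H / absorbed_at 1 H. *)
Lemma sqlen_absorbed_at_cvg H : inert L phi H ->
  [/\ forall n, sqlen H (absorbed_at phi n.+1 H) \is a fin_num, residual H \is a fin_num &
     (fun n => fine (sqlen H (absorbed_at phi n.+1 H))) @ \oo --> fine (residual H)].
Proof.
move=> /inertP h1.
have bdec m n : (m <= n)%N -> sqlen H (absorbed_at phi n H) <= sqlen H (absorbed_at phi m H).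
  by move=> le_mn; apply: sqlen_mono => // x _; apply: absorbed_at_le.
have bfin n : sqlen H (absorbed_at phi n.+1 H) \is a fin_num.
  by rewrite ge0_fin_numE ?sqlen_ge0 //; exact: le_lt_trans (bdec 1%N n.+1 isT) h1.
have st n : {subset absorbed_at phi n H <= absorbed phi H}.
  by move=> x xs; apply/mk_submodP; exists n.
pose d n := sqlen (submod_cap H (absorbed phi H)) (absorbed_at phi n.+1 H).
have bE n : sqlen H (absorbed_at phi n.+1 H) = residual H + d n.
  by apply: (sqlen_add hL) => x _; exact: st.
have lfin : residual H \is a fin_num.
  rewrite ge0_fin_numE ?sqlen_ge0 //; apply: le_lt_trans h1.
  by rewrite bE leeDl // sqlen_ge0.
have dfin n : d n \is a fin_num.
  have := bfin n; rewrite !ge0_fin_numE ?sqlen_ge0 // bE; apply: le_lt_trans.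
  by rewrite leeDr // sqlen_ge0.
split=> //; apply/cvgrPdist_le => e e0.
(* d is nonincreasing, so one small value is enough. *)
suff [N dN] : exists N, d N <= e%:E.
  exists N => // n /= le_Nn; rewrite bE fineD // opprD addrA subrr sub0r normrN.
  rewrite ger0_norm ?fine_ge0 ?sqlen_ge0 // -lee_fin fineK //; apply: le_trans dN.
  rewrite -(@leeD2lE _ (residual H)) // -!bE; exact: bdec.
apply: contrapT => /forallNP nd.
suff : d 0%N <= d 0%N - e%:E.
  rewrite leeBrDr // -{2}[d 0%N]adde0 leeD2lE // lee_fin => /(lt_le_trans e0).
  by rewrite ltxx.
apply: (sqlen_upper hL) => // s sT.
have [|n sn] := @span_sub_absorbed _ _ phi s H.
  by move=> x /sT /submod_capP[].
have := nd n; move/negP; rewrite -ltNge => en.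
rewrite leeBrDr //.
have -> : d 0%N = d n + sqlen (submod_cap (submod_cap H (absorbed phi H)) (absorbed_at phi n.+1 H))
                         (absorbed_at phi 1 H).
  by apply: (sqlen_add hL) => // x _; exact: absorbed_at_le.
rewrite addeC; apply: leeD; first exact: ltW.
apply: sqlen_mono => // x xs; apply/submod_capP; split; first exact: sT.
exact: absorbed_at_le (leqnSn n) _ (sn _ xs).
Qed.

(** L(T_(n+1)(H) / H) is the sum of the lengths of the steps T_(j+1)(H) / T_j(H) for
    1 <= j <= n, so its mean has the same limit as the steps. *)
Lemma entropy_cvg H : inert L phi H ->
  [/\ forall n, sqlen (T n.+1 H) H \is a fin_num, residual H \is a fin_num &
     (fun n => n.+1%:R^-1 * fine (sqlen (T n.+1 H) H))%R @ \oo --> fine (residual H)].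
Proof.
move=> /sqlen_absorbed_at_cvg [bfin lfin bcvg].
(* The term of index 0 stands for T_1(H) / H, which is zero; thus the length of
   T_(n+1)(H) / H is the sum of the first n+1 terms of u. *)
pose u n := if n is m.+1 then fine (sqlen H (absorbed_at phi m.+1 H)) else 0%R.
have tE n : sqlen (T n.+1 H) H = (series u n.+1)%:E.
  elim: n => [|n IH].
    rewrite /series /= big_nat1 sqlen_eq0 // => x; by rewrite traj1.
  by rewrite sqlen_trajS IH /series /= [in RHS]big_nat_recr //= addeC EFinD fineK.
split=> //; first by move=> n; rewrite tE.
have -> : (fun n => n.+1%:R^-1 * fine (sqlen (T n.+1 H) H))%R = arithmetic_mean u.
  by apply/funext => n; rewrite tE.
by apply: cesaro; rewrite -cvg_shiftS.
Qed.

Lemma intrinsic_entropy_atE H : inert L phi H ->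
  intrinsic_entropy_at L phi H = residual H.
Proof.
move=> /entropy_cvg [tfin lfin tcvg].
rewrite /intrinsic_entropy_at -(fineK lfin); apply: cvg_lim => //.
rewrite -cvg_shiftS.
have -> : [sequence (L (subquotient (T n.+1 H) H) * (n.+1%:R^-1)%:E)]_n =
    EFin \o (fun n => n.+1%:R^-1 * fine (sqlen (T n.+1 H) H))%R.
  by apply/funext => n /=; rewrite EFinM fineK ?tfin // muleC.
by apply: cvg_EFin; [exact: nearW|].
Qed.

End Limit.

(** * The entropy as a supremum over finitely generated submodules *)

Section EntropyAsSup.
Variables (K : realType) (R : idomainType) (L : lmodType R -> \bar K).
Hypothesis hL : length_function L.
Hypothesis L_torsion : forall (I : submodClosed R^o) (r : R),
  r != 0 -> (r : R^o) \in I -> (L (quot_module I) < +oo)%E.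
Hypothesis L_unbounded : forall c : K, exists2 r : R, r != 0 &
  forall I : submodClosed R^o, (forall s : R, (s : R^o) \in I -> exists t, s = t * r) ->
  (c%:E <= L (quot_module I))%E.
Local Notation sqlen := (sqlen L).

Section Cyclic.
Variables (V : lmodType R).
Implicit Types (A B D : submodClosed V).

Lemma annihilator_subproof B (y : V) : subsemimod_closed
  (fun a : R^o => `[< (a : R) *: y \in B >]).
Proof.
split; first split.
- by apply/asboolP; rewrite scale0r rpred0.
- by move=> a b /asboolP ha /asboolP hb; apply/asboolP; rewrite scalerDl rpredD.
- by move=> c a /asboolP ha; apply/asboolP; rewrite -scalerA rpredZ.
Qed.

Definition annihilator B y : submodClosed R^o := mk_submod (annihilator_subproof B y).

Lemma annihilatorP B y (a : R) : (a : R^o) \in annihilator B y <-> a *: y \in B.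
Proof. exact: mk_submodP. Qed.

Lemma sqlen_cyclic_fin A B (y : V) (r : R) :
  (forall x, x \in A -> exists a, x - a *: y \in B) -> r != 0 -> r *: y \in B ->
  (sqlen A B < +oo)%E.
Proof.
move=> Ay r0 ry; apply: le_lt_trans (@L_torsion (annihilator B y) r r0 _); last first.
  exact/annihilatorP.
apply: (@length_subquot _ _ _ hL (quot_module (annihilator B y)) (subquotient A B)
  (fun p q => exists (a : R^o) (x : V),
     [/\ p = quot_linear (annihilator B y) a, sqrep x q & x - (a : R) *: y \in B])).
- move=> c p q p' q' [a [x [-> xq xa]]] [a' [x' [-> xq' xa']]].
  exists (c *: a + a'), (c *: x + x'); split; [by rewrite linearP|exact: sqrep_lin|].
  rewrite scalerDl opprD addrACA -[(c *: a : R^o) *: y]scalerA -scalerBr.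
  by rewrite rpredD // rpredZ.
- move=> q; have [x xq] := sqrep_surj q; have [a xa] := Ay x (sqrep_mem xq).
  by exists (quot_linear (annihilator B y) (a : R^o)), a, x.
- move=> q [a [x [/esym/quot_proj0P/annihilatorP aB xq xa]]].
  apply: sqrep_eq0 xq _; by have := rpredD xa aB; rewrite subrK.
Qed.

Lemma sqlen_cyclic_ge A B (y : V) c (r : R) :
  (forall I : submodClosed R^o, (forall s : R, (s : R^o) \in I -> exists t, s = t * r) ->
    (c <= L (quot_module I))%E) ->
  y \in A -> (forall a, a *: y \in B -> exists t, a = t * r) -> (c <= sqlen A B)%E.
Proof.
move=> cr yA aB; have := cr (annihilator B y).
have /[swap]/[apply] : forall s : R, (s : R^o) \in annihilator B y -> exists t, s = t * r.
  by move=> s /annihilatorP; apply: aB.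
move=> /le_trans; apply.
apply: (@length_subquot _ _ _ hL (subquotient A B) (quot_module (annihilator B y))
  (fun p q => exists2 a : R^o, sqrep ((a : R) *: y) p & q = quot_linear (annihilator B y) (a : R^o))).
- move=> d p q p' q' [a ap ->] [a' ap' ->]; exists (d * a + a'); last first.
    by rewrite -linearP.
  by rewrite scalerDl -scalerA; exact: sqrep_lin.
- move=> q; have [a ->] := quot_projP q.
  have /(sqrep_ex B)[p pa] : (a : R) *: y \in A by rewrite rpredZ.
  by exists p, a.
- by move=> q [a /sqrep0[_ aB'] ->]; apply/quot_proj0P/annihilatorP.
Qed.

(** Induction on the generators y :: s. If r y lies in B = span s + A for some nonzero r, then
    D / (D /\ B) is a subquotient of the torsion cyclic module R y / (R y /\ B), which has
    finite length; otherwise torsion forces D to lie in B. In both cases D /\ B modulo A comes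
    from torsion elements of span s. *)
Lemma sqlen_torsion_fin s A D : {subset D <= span_of s} ->
  (forall x, x \in D -> exists2 r : R, r != 0 & r *: x \in A) -> (sqlen D A < +oo)%E.
Proof.
elim: s D => [|y s IH] D Ds Dt.
  by rewrite sqlen_eq0 // => x /Ds /span_nilP ->; exact: rpred0.
pose B := submod_add (span_of s) A.
have sB x : x \in span_of s -> x \in B.
  by move=> xs; apply/submod_addP; exists x, 0; rewrite rpred0 addr0.
have AB x : x \in A -> x \in B.
  by move=> xA; apply/submod_addP; exists 0, x; rewrite rpred0 add0r.
rewrite (@sqlen_add _ _ _ hL _ D B A); last by move=> x _ /AB.
apply: lte_add_pinfty.
  have [[r r0 ry]|nr] := pselect (exists2 r : R, r != 0 & r *: y \in B).
    apply: (@sqlen_cyclic_fin _ _ y r) => // x /Ds /span_consP[a [z [/sB zs ->]]].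
    by exists a; rewrite addrC addKr.
  rewrite sqlen_eq0 // => x xD; have [r r0 /AB rx] := Dt x xD.
  have /span_consP[a [z [/sB zs xE]]] := Ds x xD.
  have [a0|a0] := eqVneq a 0; first by rewrite xE a0 scale0r add0r.
  case: nr; exists (r * a); first by rewrite mulf_neq0.
  have := memB rx (rpredZ r zs); rewrite xE scalerDr addrK scalerA; exact.
(* D' collects the elements of span s that differ from one of D by an element of A. *)
pose D' := submod_cap (span_of s) (submod_add D A).
have D'P z : z \in D' -> exists x a, [/\ x \in D, a \in A & z = x + a].
  by move=> /submod_capP[_ /submod_addP].
apply: le_lt_trans (IH D' _ _).
- apply: (@sqlen_rel _ _ _ hL _ _ _ _ _ _ (fun z x => z - x \in A)).
  + move=> a x y1 x' y1' h h'; rewrite opprD addrACA -scalerBr.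
    by rewrite rpredD // rpredZ.
  + move=> x /submod_capP[xD /submod_addP[z [a [zs aA xE]]]]; exists z.
      apply/submod_capP; split=> //; apply/submod_addP.
      by exists x, (- a); split; [|exact: memN|rewrite xE addrK].
    by rewrite xE opprD addrA subrr sub0r memN.
  + by move=> z x _ zA _ zx; have := memB zA zx; rewrite subKr.
- by move=> z /submod_capP[].
- move=> z /D'P[x [a [xD aA ->]]]; have [r r0 rx] := Dt x xD.
  by exists r => //; rewrite scalerDr rpredD // rpredZ.
Qed.

Lemma saturation_subproof A D : subsemimod_closed
  (fun x : V => `[< x \in D /\ exists2 r : R, r != 0 & r *: x \in A >]).
Proof.
split; first split.
- by apply/asboolP; rewrite rpred0; split=> //; exists 1; rewrite ?oner_neq0 // scaler0 rpred0.
- move=> x y /asboolP[xD [r r0 rx]] /asboolP[yD [q q0 qy]]; apply/asboolP.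
  rewrite rpredD //; split=> //; exists (r * q); first by rewrite mulf_neq0.
  rewrite scalerDr rpredD // -scalerA; last by rewrite rpredZ.
  by rewrite scalerA mulrC -scalerA rpredZ.
- move=> a x /asboolP[xD [r r0 rx]]; apply/asboolP; rewrite rpredZ //; split=> //.
  by exists r => //; rewrite scalerA mulrC -scalerA rpredZ.
Qed.

(** The inverse image in D of the torsion of D / (D /\ A). *)
Definition saturation A D : submodClosed V := mk_submod (saturation_subproof A D).

Lemma saturationP A D x : x \in saturation A D <->
  x \in D /\ exists2 r : R, r != 0 & r *: x \in A.
Proof. exact: mk_submodP. Qed.

Lemma sqlen_saturation_fin A D : finitely_generated D -> (sqlen (saturation A D) A < +oo)%E.
Proof.
move=> /fgP[s Ds]; apply: (@sqlen_torsion_fin s) => x /saturationP[] //.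
by rewrite Ds.
Qed.

End Cyclic.

Section Dynamics.
Variables (V : lmodType R) (phi : {linear V -> V}).
Implicit Types (A B H : submodClosed V).
Local Notation T := (trajectory phi).
Local Notation residual := (residual L phi).

(** The map phi^k induces an isomorphism of A / absorbed A onto T_(k+1)(A) / absorbed T_(k+1)(A):
    phi sends T_k(A) into T_(k+1)(A), so all of T_k(A) is absorbed at the first step. *)
Lemma residual_traj k A : residual (T k.+1 A) = residual A.
Proof.
pose r (x y : V) := iter k phi x - y \in absorbed phi (T k.+1 A).
have rP (a : R) x y x' y' : r x y -> r x' y' -> r (a *: x + x') (a *: y + y').
  rewrite /r => rxy rxy'.
  rewrite iter_linear opprD addrACA -scalerBr.
  by rewrite rpredD // rpredZ.
apply/le_anti/andP; split.
  apply: (@sqlen_rel _ _ _ hL _ _ _ _ _ _ r) => //.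
    move=> _ /trajSP[t [h [tT hA ->]]]; exists h => //.
    rewrite /r opprD addrCA subrr addr0 memN //; apply/absorbedP; split.
      by apply: traj_mono tT.
    by exists 1; rewrite traj1; apply: (iter_traj 1 tT).
  move=> x y _ /absorbedP[xA [n xn]] yT; rewrite /r => xyT.
  suff xT : iter k phi x \in absorbed phi (T k.+1 A) by have := memB xT xyT; rewrite subKr.
  apply/absorbedP; split; first exact: mem_traj.
  exists n.+1; rewrite traj_traj -iterD; apply: recur_step xn.
  by rewrite addSn -addnS leq_addr.
apply: (@sqlen_rel _ _ _ hL _ _ _ _ _ _ (fun x y => r y x)).
- by move=> a x y x' y'; exact: rP.
- move=> h hH; exists (iter k phi h); first exact: mem_traj.
  by rewrite /r subrr rpred0.
- move=> x y _ xT yA; rewrite /r => yx; apply/absorbedP; split=> //.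
  have := rpredD yx xT; rewrite subrK => /absorbedP[_ [n]].
  move=> /(recur_step (leqnSn n)); rewrite traj_traj -iterD.
  by exists (n.+1 + k)%N.
Qed.

(** Equivalently, x is killed by a nonzero polynomial in phi, here with leading term r X^n. *)
Definition algebraic (x : V) : Prop :=
  exists n (r : R), r != 0 /\ r *: iter n phi x \in T n (span_of [:: x]).

(** A power of phi large enough for all generators, and the product of the scalars found
    for each of them. *)
Lemma algebraic_span s A : {in s, forall x, algebraic x} -> {subset span_of s <= A} ->
  exists n (r : R), r != 0 /\ forall a, a \in span_of s -> r *: iter n phi a \in T n A.
Proof.
elim: s => [|y s IH] alg sA.
  by exists 0%N, 1; split=> [|a /span_nilP ->]; rewrite ?oner_neq0 // iter_lin0 scaler0 rpred0.
have [|x xs|n [r [r0 hr]]] := IH.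
- by move=> x xs; apply: alg; rewrite inE xs orbT.
- by apply: sA; apply/span_consP; exists 0, x; rewrite scale0r add0r.
have [m [q [q0 hq]]] := alg y (mem_head _ _).
have up k k' a : (k <= k')%N -> forall c : R, c *: iter k phi a \in T k A ->
    c *: iter k' phi a \in T k' A.
  move=> le_kk' c; rewrite -!iter_linZ; exact: recur_step.
have {}hq : q *: iter m phi y \in T m A.
  move: hq; apply: traj_mono => // x /span_consP[a [z [/span_nilP -> ->]]].
  by rewrite addr0; apply: sA; rewrite rpredZ // mem_span // mem_head.
exists (maxn m n), (r * q); split; first by rewrite mulf_neq0.
move=> _ /span_consP[a [z [zs ->]]]; rewrite iter_linear scalerDr rpredD //.
  rewrite scalerA mulrAC -scalerA rpredZ //.
  by rewrite (up m) ?leq_maxl.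
by rewrite mulrC -scalerA rpredZ // (up n) ?leq_maxr // hr.
Qed.

Section AlgebraicTrajectory.
Variables (A : submodClosed V) (n : nat) (r : R).
Hypothesis hr : forall a, a \in A -> r *: iter n phi a \in T n A.

Lemma algebraic_traj j x : x \in T (n + j) A -> r ^+ j *: x \in T n A.
Proof.
elim: j x => [|j IH] x; first by rewrite addn0 scale1r.
rewrite addnS => /trajSP[t [h [tT hA ->]]].
rewrite exprSr -scalerA; apply: IH; rewrite scalerDr rpredD //; first exact: rpredZ.
by rewrite [(n + j)%N]addnC iterD -iter_linZ; apply: iter_traj; exact: hr.
Qed.

(** The quotient T_(n+1)(A) / T_n(A) is finitely generated and killed by r, hence of finite
    length. *)
Lemma algebraic_inert : r != 0 -> finitely_generated A -> inert L phi (T n A).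
Proof.
move=> r0 /(traj_fg phi n)/fgP[s sT]; apply/(inertP hL).
apply: (@sqlen_torsion_fin _ s); first by move=> x; rewrite sT.
move=> x xT; exists r => //; apply/absorbed_atP; rewrite rpredZ //; split=> //.
rewrite traj1 iter_linZ -[r]expr1; apply: algebraic_traj.
by rewrite addn1; apply: (iter_traj 1 xT).
Qed.

End AlgebraicTrajectory.

Lemma absorbed_mono A B : {subset A <= B} -> {subset absorbed phi A <= absorbed phi B}.
Proof.
move=> sAB x /absorbedP[/sAB xB [n xn]]; apply/absorbedP; split=> //; exists n.
exact: traj_mono xn.
Qed.

Lemma residual_le_sup H c : (forall s, {subset span_of s <= H} -> (residual (span_of s) <= c)%E) ->
  (residual H <= c)%E.
Proof.
move=> h; apply: (sqlen_upper hL) => s sH; apply: le_trans (h s sH).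
by apply: (sqlen_mono hL) => // x _; exact: absorbed_mono.
Qed.

Lemma residual_entropy H : inert L phi H -> (residual H <= intrinsic_entropy L phi)%E.
Proof.
move=> iH; rewrite -(intrinsic_entropy_atE hL iH).
by apply: ereal_sup_ubound; exists H.
Qed.

(** When x is not algebraic, R[X]x is free on x, and H = Rx + r R[X]x is inert because
    H + phi H = H + R phi x with r phi x in H. A multiple a x is absorbed only if r divides a:
    the coefficient of phi^n x in an element of T_n(H) is divisible by r. So the residual length
    of H is at least the length of R / r R, which is as large as desired. *)
Section Transcendental.
Variables (x : V) (r : R).
Hypothesis x_free : ~ algebraic x.
Local Notation X := (span_of [:: x]).

Lemma free_coef n a : a *: iter n phi x \in T n X -> a = 0.
Proof.
by move=> h; apply/eqP/negP => /negP a0; apply: x_free; exists n, a.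
Qed.

Lemma traj_cyclicP n y : y \in T n.+1 X ->
  exists t b, t \in T n X /\ y = t + b *: iter n phi x.
Proof.
move=> /trajSP[t [h [tT /span_consP[b [z [/span_nilP -> ->]]] ->]]].
by exists t, b; rewrite addr0 iter_linZ.
Qed.

(** In a free module, the degree of r y is that of y: coefficients of high degree are removed
    one at a time. *)
Lemma free_traj_div n m y : y \in T m X -> r != 0 -> r *: y \in T n X -> y \in T n X.
Proof.
move=> yT r0; elim: m yT => [|m IH] yT ryT; first exact: traj_mono yT.
have [le_mn|lt_nm] := ltnP m n; first by apply: traj_mono yT.
have [t [b [tT yE]]] := traj_cyclicP yT.
suff b0 : b = 0 by apply: IH ryT; rewrite yE b0 scale0r addr0.
apply/eqP; rewrite -(mulrI_eq0 b (mulfI r0)); apply/eqP/(@free_coef m).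
have := memB (traj_mono lt_nm (fun _ => id) ryT) (rpredZ r tT).
by rewrite yE scalerDr addrC addKr scalerA.
Qed.

Lemma padded_subproof n : subsemimod_closed (fun z : V =>
  `[< exists t y m, [/\ t \in T n X, y \in T m X & z = t + r *: y] >]).
Proof.
split; first split.
- by apply/asboolP; exists 0, 0, 0%N; rewrite !rpred0 scaler0 addr0.
- move=> _ _ /asboolP[t [y [m [tT yT ->]]]] /asboolP[t' [y' [m' [tT' yT' ->]]]].
  apply/asboolP; exists (t + t'), (y + y'), (maxn m m').
  rewrite rpredD // scalerDr addrACA; split=> //.
  by rewrite rpredD //; [apply: traj_mono yT|apply: traj_mono yT'];
     rewrite ?leq_maxl ?leq_maxr.
- move=> a _ /asboolP[t [y [m [tT yT ->]]]]; apply/asboolP.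
  exists (a *: t), (a *: y), m; rewrite !rpredZ // scalerDr; split=> //.
  by rewrite !scalerA mulrC.
Qed.

(** T_n(Rx) + r R[X]x; the module described above is [padded 1]. *)
Definition padded n : submodClosed V := mk_submod (padded_subproof n).

Lemma paddedP n z : z \in padded n <->
  exists t y m, [/\ t \in T n X, y \in T m X & z = t + r *: y].
Proof. exact: mk_submodP. Qed.

Lemma padded_traj n : {subset T n (padded 1) <= padded n}.
Proof.
apply: traj_sub => i _ lt_in /paddedP[t [y [m [tT yT ->]]]]; apply/paddedP.
exists (iter i phi t), (iter i phi y), (i + m)%N; split.
- by apply: traj_mono (iter_traj i tT) => //; rewrite addn1.
- exact: iter_traj.
- by rewrite iter_linD iter_linZ.
Qed.

Lemma mem_padded1 : x \in padded 1.
Proof.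
apply/paddedP; exists x, 0, 0%N; rewrite rpred0 scaler0 addr0; split=> //.
by rewrite traj1 mem_span // mem_head.
Qed.

Lemma scaled_padded1 m y : y \in T m X -> r *: y \in padded 1.
Proof.
by move=> yT; apply/paddedP; exists 0, y, m; rewrite rpred0 add0r.
Qed.

Lemma padded_inert : r != 0 -> inert L phi (padded 1).
Proof.
move=> r0; apply/(inertP hL); apply: (@sqlen_cyclic_fin _ _ _ x r) => //.
  move=> _ /paddedP[t [y [m [tT yT ->]]]].
  have [a [z [/span_nilP -> tE]]] : exists a z, z \in span_of [::] /\ t = a *: x + z.
    by apply/span_consP; rewrite -(traj1 phi).
  exists a; rewrite tE addr0 addrC addKr; apply/absorbed_atP; rewrite traj1.
  split; first exact: scaled_padded1 yT.
  by rewrite iter_linZ; apply: scaled_padded1 (iter_traj 1 yT).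
apply/absorbed_atP; rewrite rpredZ ?mem_padded1 //; split=> //.
rewrite traj1 iter_linZ; apply: (@scaled_padded1 2).
by apply: mem_traj => //; rewrite mem_span // mem_head.
Qed.

Lemma padded_absorbed a : r != 0 -> a *: x \in absorbed phi (padded 1) -> exists t, a = t * r.
Proof.
move=> r0 /absorbedP[_ [n /padded_traj/paddedP[t [y [m [tT yT]]]]]].
rewrite iter_linZ => axE.
have yTn : y \in T n.+1 X.
  apply: (free_traj_div yT r0).
  have -> : r *: y = a *: iter n phi x - t by rewrite axE addrC addKr.
  rewrite memB //; last by apply: traj_mono tT.
  by rewrite rpredZ // mem_traj // mem_span // mem_head.
have [t' [b [tT' yE]]] := traj_cyclicP yTn.
exists b; apply/eqP; rewrite -subr_eq0; apply/eqP/(@free_coef n).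
rewrite scalerBl axE yE scalerDr scalerA [r * b]mulrC addrA addrK.
by rewrite rpredD // rpredZ.
Qed.

End Transcendental.

Lemma transcendental_entropy x : ~ algebraic x -> intrinsic_entropy L phi = +oo%E.
Proof.
move=> x_free; apply/eqyP => c _; have [r r0 hr] := L_unbounded c.
apply: le_trans (residual_entropy (padded_inert x r0)).
apply: (sqlen_cyclic_ge hr (mem_padded1 x r)) => a.
exact: padded_absorbed.
Qed.

(** In the first case every finitely generated submodule has an inert trajectory; in the second
    one every bound by the entropy is trivial. *)
Lemma entropy_dichotomy : (forall x, algebraic x) \/ intrinsic_entropy L phi = +oo%E.
Proof.
have [|/existsNP[x /transcendental_entropy]] := pselect (forall x, algebraic x).
  by left.
by right.
Qed.

Lemma algebraic_fg A : (forall x, algebraic x) -> finitely_generated A ->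
  exists n (r : R), r != 0 /\ forall a, a \in A -> r *: iter n.+1 phi a \in T n.+1 A.
Proof.
move=> alg /fgP[s As].
have [||n [r [r0 hr]]] := @algebraic_span s A; [by []|by move=> x; rewrite As|].
exists n, r; split=> // a; rewrite As => /hr; rewrite -!iter_linZ.
exact: recur_step.
Qed.

(** Together with [entropy_le], this says that the entropy is the supremum of the residual
    lengths of the finitely generated submodules, inert or not. *)
Lemma residual_le_entropy A : finitely_generated A -> (residual A <= intrinsic_entropy L phi)%E.
Proof.
move=> fA; have [alg|->] := entropy_dichotomy; last by rewrite leey.
have [n [r [r0 hr]]] := algebraic_fg alg fA.
by rewrite -(residual_traj n); apply: residual_entropy; exact: algebraic_inert hr r0 fA.
Qed.

Lemma entropy_le c : (forall s, (residual (span_of s) <= c)%E) ->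
  (intrinsic_entropy L phi <= c)%E.
Proof.
move=> h; apply: ge_ereal_sup => _ [H iH <-].
by rewrite (intrinsic_entropy_atE hL iH); apply: residual_le_sup => s _.
Qed.

End Dynamics.
End EntropyAsSup.

(** * Exact sequences *)

(** A bounded error disappears after division by n + 1. *)
Lemma mean_limit_le (K : realType) (x y z : nat -> K) (a b d c : K) :
  (fun n => n.+1%:R^-1 * x n) @ \oo --> a -> (fun n => n.+1%:R^-1 * y n) @ \oo --> b ->
  (fun n => n.+1%:R^-1 * z n) @ \oo --> d ->
  (forall n, x n + y n <= z n + c) -> a + b <= d.
Proof.
move=> xa yb zd h; rewrite -[d]addr0 -(mulr0 c).
have hc : (fun n => c * harmonic n) @ \oo --> c * 0 by apply: cvgMl_tmp; exact: cvg_harmonic.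
apply: ler_cvg_to (cvgD xa yb) (cvgD zd hc) _.
apply: nearW => n /=; rewrite -mulrDr [X in _ <= _ + X]mulrC -mulrDr.
by rewrite ler_pM2l ?invr_gt0 //; exact: h.
Qed.

Section Exactness.
Variables (K : realType) (R : idomainType) (L : lmodType R -> \bar K).
Hypothesis hL : length_function L.
Hypothesis L_torsion : forall (I : submodClosed R^o) (r : R),
  r != 0 -> (r : R^o) \in I -> (L (quot_module I) < +oo)%E.
Hypothesis L_unbounded : forall c : K, exists2 r : R, r != 0 &
  forall I : submodClosed R^o, (forall s : R, (s : R^o) \in I -> exists t, s = t * r) ->
  (c%:E <= L (quot_module I))%E.
Local Notation sqlen := (sqlen L).
Local Notation ent phi := (intrinsic_entropy L phi).

Lemma residual_ext (V : lmodType R) (phi : {linear V -> V}) (A B : submodClosed V) :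
  A =i B -> residual L phi A = residual L phi B.
Proof.
move=> eAB; apply: (sqlen_ext hL) => // x; apply/idP/idP; apply: absorbed_mono => y.
  by rewrite eAB.
by rewrite eAB.
Qed.

Lemma fg_image (V W : lmodType R) (f : {linear V -> W}) A :
  finitely_generated A -> finitely_generated (submod_image f A).
Proof.
move=> /fgP[s As]; apply/fgP; exists (map f s) => y; rewrite -image_span.
by apply/idP/idP => /submod_imageP[x xA ->]; apply: mem_image; move: xA; rewrite As.
Qed.

Lemma entropy_ge0 (V : lmodType R) (phi : {linear V -> V}) : (0 <= ent phi)%E.
Proof.
apply: le_trans (residual_le_entropy hL L_torsion L_unbounded phi (fg_span [::])).
exact: residual_ge0.
Qed.

Section Embedding.
Variables (V W : lmodType R) (phi : {linear V -> V}) (psi : {linear W -> W}).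
Variable f : {linear V -> W}.
Hypothesis fC : forall x, f (phi x) = psi (f x).
Hypothesis f_inj : injective f.

Lemma residual_image A : residual L psi (submod_image f A) = residual L phi A.
Proof.
have f_absorbed x : f x \in absorbed psi (submod_image f A) <-> x \in absorbed phi A.
  split=> [/absorbedP[fxA [n]]|/absorbedP[xA [n xn]]].
    rewrite -(iterC fC) (traj_image fC) => /submod_imageP[y yT /f_inj xy].
    apply/absorbedP; split; last by exists n; rewrite xy.
    by move/submod_imageP: fxA => [z zA /f_inj ->].
  apply/absorbedP; split; first exact: mem_image.
  by exists n; rewrite -(iterC fC) (traj_image fC) mem_image.
apply/le_anti/andP; split.
  apply: (@sqlen_rel _ _ _ hL _ _ _ _ _ _ (fun x y => y = f x)).
  - by move=> a x y x' y' -> ->; rewrite linearP.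
  - by move=> _ /submod_imageP[x xA ->]; exists x.
  - by move=> x y _ /f_absorbed xT _ ->.
apply: (@sqlen_rel _ _ _ hL _ _ _ _ _ _ (fun y x => y = f x)).
- by move=> a x y x' y' -> ->; rewrite linearP.
- by move=> x xA; exists (f x) => //; apply: mem_image.
- by move=> y x _ yT _ yx; apply/f_absorbed; rewrite -yx.
Qed.

Lemma entropy_embedding : (ent phi <= ent psi)%E.
Proof.
apply: (entropy_le hL) => s; rewrite -residual_image.
by apply: (residual_le_entropy hL L_torsion L_unbounded); apply/fg_image/fg_span.
Qed.

End Embedding.

Section Extension.
Variables (V' V V'' : lmodType R).
Variables (phi' : {linear V' -> V'}) (phi : {linear V -> V}) (phi'' : {linear V'' -> V''}).
Variables (i : {linear V' -> V}) (p : {linear V -> V''}).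
Hypothesis iC : forall x, i (phi' x) = phi (i x).
Hypothesis pC : forall x, p (phi x) = phi'' (p x).
Hypothesis i_inj : injective i.
Hypothesis exact_ip : forall y, p y = 0 <-> exists x, i x = y.
Hypothesis p_surj : forall z, exists y, p y = z.

Local Notation T := (trajectory phi).

Lemma p_traj n (A : submodClosed V) x :
  p x \in trajectory phi'' n (submod_image p A) ->
  exists t b, t \in T n A /\ x = t + i b.
Proof.
rewrite (traj_image pC) => /submod_imageP[t tT ptx].
have /exact_ip[b ib] : p (x - t) = 0 by rewrite linearB ptx subrr.
by exists t, b; rewrite ib addrC subrK.
Qed.

(** Modulo V', the elements phi^n x fall in T_n(A); the submodule spanned by s' collects the
    differences. It is the finitely generated submodule of V' that accounts for what p loses. *)
Lemma lift_boundary n (A : submodClosed V) (s : seq V) :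
  {subset span_of s <= A} ->
  (forall x, x \in span_of s ->
    p (iter n phi x) \in trajectory phi'' n (submod_image p A)) ->
  exists s' : seq V', (forall b, b \in span_of s' -> i b \in T n.+1 A) /\
    (forall x, x \in span_of s -> exists2 b, b \in span_of s' & iter n phi x - i b \in T n A).
Proof.
elim: s => [|y s IH] sA sp.
  exists [::]; split=> [b /span_nilP ->|x /span_nilP ->].
    by rewrite linear0 rpred0.
  by exists 0; rewrite ?rpred0 // iter_lin0 linear0 subr0 rpred0.
have ss x : x \in span_of s -> x \in span_of (y :: s).
  by move=> xs; apply/span_consP; exists 0, x; rewrite scale0r add0r.
have [|x /ss /sp //|s' [s'T s'P]] := IH; first by move=> x /ss /sA.
have ys : y \in span_of (y :: s) by apply/mem_span/mem_head.
have [t [b [tT yE]]] := p_traj (sp y ys).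
have ibE : i b = iter n phi y - t by rewrite yE addrC addKr.
have ibT : i b \in T n.+1 A.
  by rewrite ibE memB ?mem_traj ?sA //; apply: traj_mono tT.
exists (b :: s'); split=> [_ /span_consP[a [z [/s'T zT ->]]]|].
  by rewrite linearP rpredD // rpredZ.
move=> _ /span_consP[a [z [/s'P[c cs zc] ->]]]; exists (a *: b + c).
  by apply/span_consP; exists a, c.
rewrite iter_linear linearP opprD addrACA -scalerBr rpredD // rpredZ //.
by rewrite ibE subKr.
Qed.

(** Filter A / absorbed A by the inverse image P of the absorbed part of p A. The quotient
    A / (A /\ P) is that of p A. A finitely generated submodule of A /\ P is pushed by phi^n
    into T_n(A) + V'; its components in V' span a finitely generated B, and if the component of
    phi^n x is absorbed in B then x is absorbed in A. So the second factor is bounded by the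
    residual length of B. *)
Lemma entropy_extension_le : (ent phi <= ent phi' + ent phi'')%E.
Proof.
apply: (entropy_le hL) => s; set A := span_of s.
pose P := submod_preimage p (absorbed phi'' (submod_image p A)).
have tP : {subset absorbed phi A <= P}.
  move=> x /absorbedP[xA [n xn]]; apply/submod_preimageP/absorbedP.
  split; first exact: mem_image.
  by exists n; rewrite -(iterC pC) (traj_image pC) mem_image.
rewrite /residual (@sqlen_add _ _ _ hL _ A P); last by move=> x _; exact: tP.
rewrite addeC; apply: leeD; last first.
  apply: (@le_trans _ _ (residual L phi'' (submod_image p A))); last first.
    by apply: (residual_le_entropy hL L_torsion L_unbounded); apply/fg_image/fg_span.
  apply: (@sqlen_rel _ _ _ hL _ _ _ _ _ _ (fun y x => y = p x)).
  - by move=> a x y x' y' -> ->; rewrite linearP.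
  - by move=> x xA; exists (p x) => //; apply: mem_image.
  - by move=> y x _ yT _ yx; apply/submod_preimageP; rewrite -yx.
apply: (sqlen_upper hL) => s1 s1P.
have s1A : {subset span_of s1 <= A} by move=> x /s1P /submod_capP[].
have [|n sn] := @span_sub_absorbed _ _ phi'' (map p s1) (submod_image p A).
  move=> y; rewrite -image_span => /submod_imageP[x /s1P /submod_capP[_] xP ->].
  exact/submod_preimageP.
have [|s' [s'T s'P]] := @lift_boundary n A s1 s1A.
  move=> x xs; rewrite (iterC pC).
  have /absorbed_atP[//] : p x \in absorbed_at phi'' n (submod_image p A).
  by apply: sn; rewrite -image_span mem_image.
apply: le_trans (residual_le_entropy hL L_torsion L_unbounded phi' (fg_span s')).
apply: (@sqlen_rel _ _ _ hL _ _ _ _ _ _ (fun b x => iter n phi x - i b \in T n A)).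
- move=> a b x b' x' h h'; rewrite iter_linear linearP opprD addrACA -scalerBr.
  by rewrite rpredD // rpredZ.
- by move=> x /s'P[b bs xb]; exists b.
move=> b x _ /absorbedP[_ [k /(recur_step (leqnSn k)) bk]] /s1A xA xb.
apply/absorbedP; split=> //; exists (k.+1 + n)%N.
have -> : iter (k.+1 + n) phi x =
    iter k.+1 phi (iter n phi x - i b) + i (iter k.+1 phi' b).
  by rewrite (iterC iC) -iter_linD subrK iterD.
rewrite rpredD //; first exact: iter_traj.
have : i (iter k.+1 phi' b) \in trajectory phi k.+1 (submod_image i (span_of s')).
  by rewrite (traj_image iC) mem_image.
move=> h; rewrite addSn -traj_traj; move: h; apply: traj_mono => //.
by move=> _ /submod_imageP[c /s'T cT ->].
Qed.

Section AlgebraicCase.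
Hypothesis alg : forall x, algebraic phi x.

(** Let A' and A'' be spanned by s' and s, and take k for which A = T_(k+1)(i A') and
    G = T_(k+1)(i A' + A'') are inert. The trajectories of G map onto those of p G and contain
    those of A. Measuring the latter modulo G and not modulo A loses only elements of G that are
    torsion modulo A; these form a module of finite length, so the loss is bounded, and the
    means of the three lengths compare in the limit. *)
Lemma residual_extension_ge (s' : seq V') (s : seq V) :
  (residual L phi' (span_of s') + residual L phi'' (submod_image p (span_of s)) <= ent phi)%E.
Proof.
pose A0 := submod_image i (span_of s').
pose S := submod_add A0 (span_of s).
have A0fg : finitely_generated A0 by apply/fg_image/fg_span.
have Sfg : finitely_generated S.
  have /fgP[t A0t] := A0fg; apply/fgP; exists (t ++ s) => x; rewrite span_cat.
  by apply/idP/idP => /submod_addP[a [b [aA bs ->]]]; apply/submod_addP;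
     exists a, b; split=> //; move: aA; rewrite A0t.
have [n [r [r0 hr]]] := algebraic_fg alg Sfg.
have [m [q [q0 hq]]] := algebraic_fg alg A0fg.
pose k := maxn n m.
have hrS a : a \in S -> r *: iter k.+1 phi a \in T k.+1 S.
  move=> /hr; rewrite -!iter_linZ; apply: recur_step; by rewrite ltnS leq_maxl.
have hqA a : a \in A0 -> q *: iter k.+1 phi a \in T k.+1 A0.
  move=> /hq; rewrite -!iter_linZ; apply: recur_step; by rewrite ltnS leq_maxr.
pose G := T k.+1 S; pose A := T k.+1 A0.
have iG : inert L phi G by exact: (algebraic_inert hL L_torsion hrS r0 Sfg).
have iA : inert L phi A by exact: (algebraic_inert hL L_torsion hqA q0 A0fg).
have AG : {subset A <= G}.
  apply: traj_mono => // x xA; apply/submod_addP.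
  by exists x, 0; rewrite rpred0 addr0.
have iP : inert L phi'' (submod_image p G).
  apply/(inertP hL); move/(inertP hL): iG; apply: le_lt_trans.
  apply: (@sqlen_rel _ _ _ hL _ _ _ _ _ _ (fun x y => y = p x)).
  - by move=> a x y x' y' -> ->; rewrite linearP.
  - by move=> _ /submod_imageP[x xA ->]; exists x.
  - move=> x y _ /absorbed_atP[xG xT] yG yx; apply/absorbed_atP; split=> //.
    by rewrite yx -(iterC pC) (traj_image pC) mem_image.
have pA j x : x \in T j A0 -> p x = 0.
  move: x; suff h : {subset T j A0 <= submod_preimage p (submod_zero V'')}.
    by move=> x /h /submod_preimageP/submod_zeroP.
  apply: traj_sub => l _ _ /submod_imageP[y ys ->]; apply/submod_preimageP/submod_zeroP.
  by apply/exact_ip; exists (iter l phi' y); rewrite (iterC iC).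
have -> : residual L phi' (span_of s') = residual L phi A.
  by rewrite /A (residual_traj hL) (residual_image iC i_inj).
have -> : residual L phi'' (submod_image p (span_of s)) = residual L phi'' (submod_image p G).
  rewrite -(residual_traj hL _ k); apply: residual_ext => y.
  rewrite -(traj_image pC); apply/idP/idP; apply: traj_mono => // z.
    move=> /submod_imageP[x xs ->]; apply: mem_image; apply/submod_addP.
    by exists 0, x; rewrite rpred0 add0r.
  move=> /submod_imageP[_ /submod_addP[a [x [aA xs ->]]] ->].
  by rewrite linearD (pA 1) ?traj1 // add0r mem_image.
apply: le_trans (residual_entropy hL iG).
have [tA lA cA] := entropy_cvg hL iA.
have [tP lP cP] := entropy_cvg hL iP.
have [tG lG cG] := entropy_cvg hL iG.
have Gfg : finitely_generated G by exact: traj_fg.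
pose D := saturation A G.
have cfin : sqlen D A \is a fin_num.
  by rewrite ge0_fin_numE ?sqlen_ge0 //; exact: sqlen_saturation_fin.
(* A chain for T_(j+1)(G) / G with middle term the elements with image in p G: its upper
   factor is the trajectory of p G, its lower factor contains the trajectory of A modulo G. *)
have key j : (sqlen (T j.+1 A) A + sqlen (trajectory phi'' j.+1 (submod_image p G)) (submod_image p G)
    <= sqlen (T j.+1 G) G + sqlen D A)%E.
  rewrite (@sqlen_add _ _ _ hL _ (T j.+1 A) G A); last by move=> x _; exact: AG.
  pose Q := submod_preimage p (submod_image p G).
  have GQ x : x \in G -> x \in Q by move=> xG; apply/submod_preimageP; exact: mem_image.
  rewrite (@sqlen_add _ _ _ hL _ (T j.+1 G) Q G); last by move=> x _; exact: GQ.
  rewrite addeAC leeD //; last first.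
    apply: (sqlen_mono hL) => // x /submod_capP[xT xG]; apply/saturationP; split=> //.
    exists (q ^+ j); first exact: expf_neq0.
    apply: (algebraic_traj hqA); rewrite addSn addnC.
    by move: xT; rewrite traj_traj.
  rewrite addeC leeD //.
    apply: (@sqlen_rel _ _ _ hL _ _ _ _ _ _ (fun x y => y = p x)).
    - by move=> a x y x' y' -> ->; rewrite linearP.
    - by move=> y; rewrite (traj_image pC) => /submod_imageP[x xA ->]; exists x.
    - by move=> x y _ /submod_preimageP xG _ ->.
  apply: (sqlen_mono hL) => // x xT; apply/submod_capP; split.
    by move: x xT; apply: traj_mono AG.
  by apply/submod_preimageP; rewrite (pA (j + k).+1) ?rpred0 // -traj_traj.
rewrite -(fineK lA) -(fineK lP) -(fineK lG) -EFinD lee_fin.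
apply: (mean_limit_le cA cP cG (c := fine (sqlen D A))) => j.
by have := key j; rewrite -(fineK cfin) -(fineK (tA j)) -(fineK (tP j)) -(fineK (tG j)) -!EFinD lee_fin.
Qed.

End AlgebraicCase.

Lemma lift_seq (s : seq V'') : exists t, map p t = s.
Proof.
elim: s => [|z s [t <-]]; first by exists [::].
by have [y <-] := p_surj z; exists (y :: t).
Qed.

(** If the entropy of V is infinite there is nothing to prove; otherwise every element of V
    is algebraic and [residual_extension_ge] applies to lifts of generators. *)
Lemma entropy_extension_ge : (ent phi' + ent phi'' <= ent phi)%E.
Proof.
have [alg|->] := entropy_dichotomy hL L_torsion L_unbounded phi; last exact: leey.
have ge s' s'' : (residual L phi' (span_of s') + residual L phi'' (span_of s'') <= ent phi)%E.
  have [s <-] := lift_seq s''.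
  rewrite -(residual_ext phi'' (image_span p s)); exact: residual_extension_ge.
have [->|Ey] := eqVneq (ent phi) +oo%E; first exact: leey.
have Efin x : (0 <= x -> x <= ent phi -> x \is a fin_num)%E.
  by move=> x0 xE; rewrite ge0_fin_numE //; apply: le_lt_trans xE _; rewrite ltey.
have e0 (W : lmodType R) (psi : {linear W -> W}) s : (0 <= residual L psi (span_of s))%E by exact: residual_ge0.
have lfin s' : residual L phi' (span_of s') \is a fin_num.
  by apply: Efin => //; apply: le_trans (ge s' [::]); rewrite leeDl.
have e''E : (ent phi'' <= ent phi)%E.
  apply: (entropy_le hL) => s''; apply: le_trans (ge [::] s''); by rewrite leeDr.
have e''fin : ent phi'' \is a fin_num.
  by apply: Efin => //; exact: entropy_ge0.
rewrite -leeBrDr //; apply: (entropy_le hL) => s'; rewrite leeBrDr //.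
rewrite -leeBrDl //; apply: (entropy_le hL) => s''; rewrite leeBrDl //.
Qed.

End Extension.
End Exactness.

(** * Modules over R[X] and the valuation length *)

Section Restriction.
Variables (R : idomainType) (M N : lmodType {poly R}) (f : {linear M -> N}).

Definition res_fun (x : res_module M) : res_module N := f x.

Lemma res_fun_linear : linear res_fun.
Proof. by move=> a x y; rewrite /res_fun [LHS]linearP. Qed.

HB.instance Definition _ := GRing.isLinear.Build R (res_module M) (res_module N) _
  res_fun res_fun_linear.

Definition res_linear : {linear res_module M -> res_module N} := res_fun.

Lemma res_linearC x : res_linear (mulX x) = mulX (res_linear x).
Proof. by rewrite /= /res_fun /mulX linearZ. Qed.

End Restriction.

Section ValuationLength.
Variables (K : realType) (R : idomainType) (v : {fraction R} -> \bar K).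
Hypothesis hv : nondiscrete_archimedean_valuation v.
Variable L : lmodType R -> \bar K.
Hypothesis hL : valuation_length v L.

Lemma valuation_length_torsion (I : submodClosed R^o) (r : R) :
  r != 0 -> (r : R^o) \in I -> (L (quot_module I) < +oo)%E.
Proof.
move=> r0 rI; rewrite hL.2; apply: (@le_lt_trans _ _ (v (tofrac r))).
  by apply: ereal_inf_lbound; exists r.
rewrite ltey; apply/eqP => /(val_infty hv)/eqP; rewrite tofrac_eq0.
exact/negP.
Qed.

(** Density of the value group provides r with v r > c; every multiple of r has at least
    that value. *)
Lemma valuation_length_unbounded (c : K) : exists2 r : R, r != 0 &
  forall I : submodClosed R^o, (forall s : R, (s : R^o) \in I -> exists t, s = t * r) ->
  (c%:E <= L (quot_module I))%E.
Proof.
have [g [/= cg [x xg]]] : [set y : K | Num.max c 0 < y] `&`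
    [set g : K | exists x, v x = g%:E] !=set0.
  apply: (val_dense hv); last exact: open_gt.
  by exists (Num.max c 0 + 1); rewrite /= ltrDl.
have [r xr] : exists r : R, x = tofrac r.
  apply/(val_ring hv); rewrite xg lee_fin; apply: le_trans (ltW cg).
  by rewrite le_max lexx orbT.
exists r.
  apply/eqP => r0; have /(val_infty hv) : x = 0 by rewrite xr r0 tofrac0.
  by rewrite xg.
move=> I Ir; rewrite hL.2; apply: le_ereal_inf_tmp => _ [s /Ir[t ->] <-].
rewrite tofracM (val_mul hv) -xr xg.
apply: (@le_trans _ _ g%:E).
  by rewrite lee_fin; apply: le_trans (ltW cg); rewrite le_max lexx.
by rewrite leeDr //; apply/(val_ring hv); exists t.
Qed.

End ValuationLength.

Theorem theorem4p1 (K : realType) (R : idomainType)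
    (v : {fraction R} -> \bar K)
    (hv : nondiscrete_archimedean_valuation v)
    (Lv : lmodType R -> \bar K)
    (hLv : valuation_length v Lv) :
  length_function (@intrinsic_valuation_entropy K R Lv).
Proof.
have hL := hLv.1.
have hT := valuation_length_torsion hv hLv.
have hU := valuation_length_unbounded hv hLv.
have emb (M N : lmodType {poly R}) (f : {linear M -> N}) : injective f ->
    (intrinsic_valuation_entropy Lv M <= intrinsic_valuation_entropy Lv N)%E.
  move=> f_inj; exact: (entropy_embedding hL hT hU (res_linearC f) f_inj).
split.
- by move=> M; exact: entropy_ge0.
- split=> [M M0|M N [f [g fK gK]]].
    apply/le_anti/andP; split; last exact: entropy_ge0.
    apply: (entropy_le hL) => s; rewrite /residual sqlen_eq0 // => x _.
    by rewrite [x]M0; exact: rpred0.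
  pose h : {linear N -> M} :=
    HB.pack g (GRing.isLinear.Build _ _ _ _ g (GRing.can2_linear fK gK)).
  apply/le_anti/andP; split; first by apply: (emb _ _ f); exact: can_inj fK.
  by apply: (emb _ _ h); exact: can_inj gK.
- move=> M' M M'' f g [f_inj ex g_surj].
  apply/le_anti/andP; split.
    exact: (entropy_extension_le hL hT hU (res_linearC f) (res_linearC g) ex).
  exact: (entropy_extension_ge hL hT hU (res_linearC f) (res_linearC g) f_inj ex g_surj).
- move=> M; apply/le_anti/andP; split; last first.
    apply: ge_ereal_sup => _ [B _ <-].
    exact: (emb _ _ (\val : {linear submod_type B -> M}) val_inj).
  apply: (entropy_le hL) => s.
  (* A finitely generated R-submodule sits in the R[X]-submodule B with the same generators,
     and its residual length can be computed in B. *)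
  pose B : submodClosed M := span_of (s : seq M).
  pose f : {linear submod_type B -> M} := \val.
  have [t ts] : exists t : seq (submod_type B), map f t = s.
    have : {subset (s : seq M) <= B} by move=> x; exact: mem_span.
    elim: (s : seq M) => [|y u IH] uB; first by exists [::].
    have [|t tu] := IH; first by move=> x xu; apply: uB; rewrite inE xu orbT.
    by exists (SubmodElt (uB y (mem_head _ _)) :: t); rewrite /= tu.
  have eqs : submod_image (res_linear f) (span_of (t : seq (res_module _))) =i span_of s.
    by move=> x; rewrite image_span -ts.
  rewrite -(residual_ext hL _ eqs) (residual_image hL (res_linearC f)); last exact: val_inj.
  apply: le_trans (residual_le_entropy hL hT hU _ (fg_span _)) _.
  by apply: ereal_sup_ubound; exists B => //; exact: fg_span.
Qed.
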